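(* Let $J$ satisfy the standing assumptions in the context, and let $\mathcal{L}$, $\mathcal{L}_{sym}$, $\mathcal{M}^{\pm}_{\mathcal{L}}$, $\mathcal{M}^{\pm}_{\mathcal{L}_{sym}}$ be as defined in the context. (a) Assume $\delta_1\in(1,2)$ or $\delta_2\in(0,1)$. Let $z_0\in\mathbb{R}^d$, $r>0$ and let $u:\mathbb{R}^d\to\mathbb{R}$ be a bounded measurable function such that $$\mathcal{M}^{+}_{\mathcal{L}}u(x)\ge 0 \quad\text{and}\quad \mathcal{M}^{-}_{\mathcal{L}}u(x)\le 0 \qquad\text{for } x\in B(z_0,r)$$ in the viscosity sense. Then there exist two constants $\alpha>0$ and $C>0$ such that $$\sup_{x,y\in B(z_0,r/2),\ x\ne y}\frac{|u(x)-u(y)|}{|x-y|^{\alpha}}\le C\left(\frac{1}{r\wedge r_0}\right)^{\alpha}\|u\|_{\infty},$$ where $\|u\|_\infty=\sup_{\mathbb{R}^d}|u|$, and where the values of $\alpha$ and $C$ depend only on $d, r_0, \lambda, \Lambda, a_1, a_2, \delta_1, \delta_2$ and $f(r_0^{-1})$. (b) In the case $\delta_1\le 1\le\delta_2$, the assertion in (a) still holds with $\mathcal{L}_{sym}$ in place of $\mathcal{L}$ (i.e. with $\mathcal{M}^{\pm}_{\mathcal{L}_{sym}}$ in place of $\mathcal{M}^{\pm}_{\mathcal{L}}$).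
   Context: Notation: $d\ge1$, $a\wedge b=\min\{a,b\}$, $B(x,r)$ is the open ball of center $x$ and radius $r$ in $\mathbb{R}^d$, $\mathbf{1}$ denotes an indicator. Throughout, $d\ge 1$ and the constants $r_0, M_0, \lambda, \Lambda, a_1, a_2, \delta_1, \delta_2$ introduced below are fixed. Standing assumptions on $J$. $J$ is a nonnegative measurable function on $\{(x,y)\in\mathbb{R}^d\times\mathbb{R}^d: x\neq y\}$, and there is $r_0>0$ such that $$M_0:=\sup_{x\in\mathbb{R}^d}\int_{\{y:|y-x|\ge r_0\}}J(x,y)\,dy<\infty,\qquad J(x,y)=\frac{f(|x-y|^{-1})}{|x-y|^d}\ \text{ for } 0<|x-y|<r_0,$$ where $f:[0,\infty)\to[0,\infty)$ is non-decreasing and there are constants $a_1,a_2>0$ and $\delta_1,\delta_2\in(0,2)$ with $$a_1 s^{\delta_1}\le\frac{f(st)}{f(t)}\le a_2 s^{\delta_2}\qquad\text{for } s\ge1,\ t\ge 1/r_0$$ (in particular $f(t)>0$ for $t\ge 1/r_0$). Operators. Fix constants $0<\lambda\le\Lambda$. For a measurable kernel $K$ on $\{x\ne y\}$ put $$L_Ku(x)=\int_{\mathbb{R}^d}\Big(u(y)-u(x)-\nabla u(x)\cdot(y-x)\mathbf{1}_{\{|y-x|<r_0\}}\mathbf{1}_{\{\delta_2\ge1\}}\Big)K(x,y)\,dy .$$ $\mathcal{L}$ is the set of all $L_K$ with $\lambda J(x,y)\le K(x,y)\le\Lambda J(x,y)$ for all $x\ne y$ (so $K$ need not be symmetric). $\mathcal{L}_{sym}$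 is the set of all $L_K\in\mathcal{L}$ with $K(x,x+z)=K(x,x-z)$ for all $x\in\mathbb{R}^d$, $z\in\mathbb{R}^d\setminus\{0\}$. For a class $\mathcal{S}$ of such operators, $$\mathcal{M}^+_{\mathcal{S}}u(x)=\sup_{L\in\mathcal{S}}Lu(x),\qquad \mathcal{M}^-_{\mathcal{S}}u(x)=\inf_{L\in\mathcal{S}}Lu(x).$$ Viscosity sense. Let $D$ be open and let $\mathcal{I}$ be one of the operators $\mathcal{M}^{\pm}_{\mathcal{S}}$. A function $u:\mathbb{R}^d\to\mathbb{R}$ that is upper (resp. lower) semicontinuous in $\overline{D}$ satisfies $\mathcal{I}u\ge 0$ (resp. $\mathcal{I}u\le0$) in $D$ in the viscosity sense if: whenever $x\in D$, $N_x\subset D$ is a neighborhood of $x$, and $\varphi$ is a $C^2$ function on $N_x$ with $\varphi(x)=u(x)$ and $\varphi(y)>u(y)$ (resp. $\varphi(y)<u(y)$) for $y\in N_x\setminus\{x\}$, the function $v$ equal to $\varphi$ on $N_x$ and to $u$ on $\mathbb{R}^d\setminus N_x$ satisfies $\mathcal{I}v(x)\ge0$ (resp. $\mathcal{I}v(x)\le0$).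
   Formalization: The constants α and C may also depend on M_0, which the context fixes; with α and C independent of M_0 the claim is false, since a far part of large mass can force u to be arbitrarily steep. *)

(* Defs.v *)
From HB Require Import structures.
From mathcomp Require Import all_boot all_order all_algebra.
From mathcomp Require Import all_classical all_reals all_analysis.

Set Implicit Arguments.
Unset Strict Implicit.
Unset Printing Implicit Defensive.

Import Order.TTheory GRing.Theory Num.Theory.
Import numFieldNormedType.Exports.

Local Open Scope classical_set_scope.
Local Open Scope ring_scope.

(* R^d is 'rV[R]_d.  Its sigma-algebra is the product of d copies of the Borel
   sigma-algebra of R, i.e. the Borel sigma-algebra of R^d. *)
Definition rV_display : measure_display. Proof. exact. Qed.

Section measurable_rV.
Context {R : realType} {d : nat}.

Let coord (i : 'I_d) (x : 'rV[R]_d) : measurableTypeR R := x ord0 i.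

Let rV_set0 : g_sigma_preimage coord set0.
Proof. exact: sigma_algebra0. Qed.

Let rV_setC A : g_sigma_preimage coord A -> g_sigma_preimage coord (~` A).
Proof. exact: sigma_algebraC. Qed.

Let rV_bigcup (F : (set 'rV[R]_d)^nat) :
  (forall i, g_sigma_preimage coord (F i)) ->
  g_sigma_preimage coord (\bigcup_i (F i)).
Proof. exact: sigma_algebra_bigcup. Qed.

HB.instance Definition _ := @isMeasurable.Build rV_display
  'rV[R]_d (g_sigma_preimage coord) rV_set0 rV_setC rV_bigcup.

Lemma measurable_coord (i : 'I_d) :
  measurable_fun setT (fun x : 'rV[R]_d => x ord0 i : measurableTypeR R).
Proof.
move=> _ Y mY; rewrite setTI; apply: sub_sigma_algebra => /=.
rewrite -bigcup_seq/=; exists i => /=; first by rewrite mem_index_enum.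
by exists Y => //; rewrite setTI.
Qed.

Lemma measurable_fun_rV d1 (T1 : measurableType d1) (f : T1 -> 'rV[R]_d) :
  (forall i, measurable_fun setT (fun t => f t ord0 i : measurableTypeR R)) ->
  measurable_fun setT f.
Proof.
move=> mf _ A mA; rewrite setTI.
have : preimage_set_system setT f (g_sigma_preimage coord) (f @^-1` A).
  by exists A => //; rewrite setTI.
rewrite -g_sigma_preimage_comp; apply: smallest_sub.
  exact: sigma_algebra_measurable.
rewrite -bigcup_seq => B [i _ [C mC <-]].
exact: (mf i measurableT C mC).
Qed.

End measurable_rV.

Section lebesgue_rV.
Context {R : realType}.

Definition cons_rV d (p : measurableTypeR R * 'rV[R]_d) : 'rV[R]_d.+1 :=
  \row_i oapp (p.2 ord0) p.1 (unlift ord0 i).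

Definition uncons_rV d (x : 'rV[R]_d.+1) : measurableTypeR R * 'rV[R]_d :=
  (x ord0 ord0, \row_i x ord0 (lift ord0 i)).

Lemma cons_rVK d : cancel (@cons_rV d) (@uncons_rV d).
Proof.
move=> [a x]; rewrite /uncons_rV /cons_rV !mxE unlift_none/=; congr pair.
by apply/rowP => i; rewrite !mxE liftK.
Qed.

Lemma measurable_cons_rV d : measurable_fun setT (@cons_rV d).
Proof.
apply: measurable_fun_rV => i.
case: (unliftP ord0 i) => [j|] ->.
- rewrite (_ : (fun _ => _) = (fun x : 'rV[R]_d => x ord0 j) \o snd).
    by apply: measurableT_comp => //; exact: measurable_coord.
  by apply/funext => p /=; rewrite mxE liftK.
- rewrite (_ : (fun _ => _) = fst) //.
  by apply/funext => p /=; rewrite mxE unlift_none.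
Qed.

Lemma measurable_uncons_rV d : measurable_fun setT (@uncons_rV d).
Proof.
apply/measurable_fun_pairP; split; first exact: measurable_coord.
apply: measurable_fun_rV => i.
rewrite (_ : (fun _ => _) = fun x : 'rV[R]_d.+1 => x ord0 (lift ord0 i)).
  exact: measurable_coord.
by apply/funext => x /=; rewrite mxE.
Qed.

Section step.
Context {d : nat} (mu : {sigma_finite_measure set 'rV[R]_d -> \bar R}).

Let l : {sigma_finite_measure set (measurableTypeR R) -> \bar R} :=
  lebesgue_measure.

Definition lebesgue_step : set 'rV[R]_d.+1 -> \bar R :=
  pushforward (l \x mu)%E (@cons_rV d).

Let m : {measure set (measurableTypeR R * 'rV[R]_d)%type -> \bar R} :=
  (l \x mu)%E.

Let step0 : lebesgue_step set0 = 0%E.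
Proof. by rewrite /lebesgue_step /pushforward preimage_set0 measure0. Qed.

Let step_ge0 A : (0 <= lebesgue_step A)%E.
Proof. exact: (measure_ge0 m). Qed.

Let step_sigma_additive : semi_sigma_additive lebesgue_step.
Proof.
move=> F mF tF mUF; rewrite /lebesgue_step /pushforward preimage_bigcup.
apply: (@measure_semi_sigma_additive _ _ _ m).
- by move=> n; rewrite -[X in measurable X]setTI; exact: measurable_cons_rV.
- apply/trivIsetP => /= i j _ _ ij; rewrite -preimage_setI.
  by move/trivIsetP : tF => /(_ _ _ _ _ ij) ->//; rewrite preimage_set0.
- rewrite -preimage_bigcup -[X in measurable X]setTI.
  exact: measurable_cons_rV.
Qed.

HB.instance Definition _ := isMeasure.Build _ _ _ lebesgue_step
  step0 step_ge0 step_sigma_additive.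

Let step_sigma_finite : sigma_finite setT lebesgue_step.
Proof.
have m_sigma_finite : sigma_finite setT m.
  have /sigma_finiteP[F [TF ndF Foo]] := sigma_finiteT l.
  have /sigma_finiteP[G [TG ndG Goo]] := sigma_finiteT mu.
  exists (fun n => F n `*` G n).
    rewrite -setXTT TF TG predeqE => -[x y]; split.
      move=> [/= [n _ Fnx] [k _ Gky]]; exists (maxn n k) => //; split.
      - by move: x Fnx; exact/subsetPset/ndF/leq_maxl.
      - by move: y Gky; exact/subsetPset/ndG/leq_maxr.
    by move=> [n _ []/= ? ?]; split; exists n.
  move=> k; have [? ?] := Foo k; have [? ?] := Goo k.
  split; first exact: measurableX.
  rewrite (_ : m _ = l (F k) * mu (G k))%E; last exact: product_measure1E.
  by rewrite lte_mul_pinfty// ge0_fin_numE.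
have [F TF mF] := m_sigma_finite.
exists (fun k => @uncons_rV d @^-1` F k).
  by rewrite -preimage_bigcup -TF preimage_setT.
move=> k; have [mFk Fkoo] := mF k; split.
  by rewrite -[X in measurable X]setTI; exact: measurable_uncons_rV.
rewrite /lebesgue_step /pushforward -comp_preimage.
rewrite (_ : _ \o _ = id) ?preimage_id//.
by apply/funext => p /=; rewrite cons_rVK.
Qed.

HB.instance Definition _ := Measure_isSigmaFinite.Build _ _ _ lebesgue_step
  step_sigma_finite.

End step.

(* Lebesgue measure on R^d: the d-fold product of Lebesgue measure on R, a unit
   point mass when d = 0. *)
Fixpoint lebesgue_rV d : {sigma_finite_measure set 'rV[R]_d -> \bar R} :=
  if d is d'.+1 then lebesgue_step (lebesgue_rV d')
  else \d_(0 : 'rV[R]_0)%R.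

Lemma lebesgue_rV_box d (A : 'I_d -> set (measurableTypeR R)) :
  (forall i, measurable (A i)) ->
  lebesgue_rV d [set x | forall i, A i (x ord0 i)] =
  (\prod_(i < d) lebesgue_measure (A i))%E.
Proof.
elim: d A => [|d IH] A mA /=.
  rewrite big_ord0 diracE (_ : _ \in _) ?mem_set//=; first by move=> [].
rewrite big_ord_recl -IH//.
rewrite /lebesgue_step /pushforward.
rewrite (_ : _ @^-1` _ =
    A ord0 `*` [set x : 'rV_d | forall i, A (lift ord0 i) (x ord0 i)]).
  rewrite product_measure1E//.
  rewrite (_ : mkset _ = \bigcap_(i in setT)
      ((fun x : 'rV[R]_d => x ord0 i) @^-1` A (lift ord0 i))).
    apply: fin_bigcap_measurable => [|i _]; first exact: finite_finset.
    rewrite -[X in measurable X]setTI.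
    exact: (measurable_coord i measurableT (mA (lift ord0 i))).
  by apply/seteqP; split => x /= h i; [move=> _; exact: h|exact: (h i I)].
apply/seteqP; split => -[a x] /=.
  move=> h; split.
    by have := h ord0; rewrite mxE unlift_none.
  by move=> i; have := h (lift ord0 i); rewrite mxE liftK.
move=> [h0 h] i; rewrite mxE; case: unliftP => [j|] ->//=; exact: h.
Qed.

End lebesgue_rV.

Section nonlocal_operators.
Context {R : realType} {d : nat}.
Implicit Types (x y z : 'rV[R]_d) (u v g phi : 'rV[R]_d -> R).
Implicit Types (J K : 'rV[R]_d -> 'rV[R]_d -> R) (A D N : set 'rV[R]_d).

(* The library norm on 'rV[R]_d is the sup norm, so the Euclidean structure is
   spelled out.  Both norms give the same topology, and topological notions
   (open, closure, continuity) are the library's. *)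
Definition edot x y : R := \sum_i x ord0 i * y ord0 i.

Definition enorm x : R := Num.sqrt (edot x x).

Definition eball z (r : R) : set 'rV[R]_d := [set x | enorm (x - z) < r].

Definition partial (i : 'I_d) g x : R := 'D_(delta_mx ord0 i) g x.

Definition grad g x : 'rV[R]_d := \row_i partial i g x.

Definition C1_on N g : Prop :=
  {in N, continuous g} /\
  forall i, {in N, forall x, derivable g x (delta_mx ord0 i)} /\
            {in N, continuous (partial i g)}.

(* Only used for open N. *)
Definition C2_on N g : Prop :=
  C1_on N g /\ forall i, C1_on N (partial i g).

(* With division by zero equal to zero, the lower bound forces f t != 0. *)
Definition admissible_profile (r0 a1 a2 delta1 delta2 : R) (f : R -> R) : Prop :=
  [/\ forall t, 0 <= t -> 0 <= f t,
      forall s t, 0 <= s -> s <= t -> f s <= f t &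
      forall s t, 1 <= s -> r0^-1 <= t ->
        a1 * s `^ delta1 <= f (s * t) / f t <= a2 * s `^ delta2].

(* Kernels are functions on {x <> y}: values on the diagonal are irrelevant. *)
Definition measurable_offdiag K : Prop :=
  measurable_fun [set p : 'rV[R]_d * 'rV[R]_d | p.1 != p.2]
    (fun p => K p.1 p.2).

Definition admissible_kernel (r0 M0 : R) (f : R -> R) J : Prop :=
  [/\ forall x y, x != y -> 0 <= J x y,
      measurable_offdiag J,
      ereal_sup [set (\int[lebesgue_rV d]_(y in [set y | (r0 <= enorm (y - x))%R])
                        (J x y)%:E)%E | x in [set: 'rV[R]_d]] = M0%:E &
      forall x y, 0 < enorm (x - y) < r0 ->
        J x y = f (enorm (x - y))^-1 / enorm (x - y) ^+ d].

(* Extended-real valued operators acting on functions on R^d. *)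
Definition operator : Type := ('rV[R]_d -> R) -> 'rV[R]_d -> \bar R.

Definition LK (r0 delta2 : R) K : operator := fun u x =>
  (\int[lebesgue_rV d]_(y in [set: 'rV[R]_d])
     ((u y - u x - edot (grad u x) (y - x)
                   * (enorm (y - x) < r0)%R%:R * (1 <= delta2)%R%:R)
      * K x y)%:E)%E.

Definition Lclass (r0 lam Lam delta2 : R) J : set operator :=
  [set LK r0 delta2 K | K in
    [set K | measurable_offdiag K /\
             forall x y, x != y -> lam * J x y <= K x y <= Lam * J x y]].

Definition Lsym (r0 lam Lam delta2 : R) J : set operator :=
  [set LK r0 delta2 K | K in
    [set K | [/\ measurable_offdiag K,
                 forall x y, x != y -> lam * J x y <= K x y <= Lam * J x y &
                 forall x z, z != 0 -> K x (x + z) = K x (x - z)]]].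

Definition Mplus (S : set operator) : operator := fun u x =>
  ereal_sup [set L u x | L in S].

Definition Mminus (S : set operator) : operator := fun u x =>
  ereal_inf [set L u x | L in S].

Definition lsc_on A u : Prop :=
  lower_semicontinuous (fun y : subspace A => (u y)%:E).

Definition usc_on A u : Prop := lsc_on A (fun y => - u y).

(* patch u N phi is equal to phi on N and to u elsewhere. *)
Definition visc_ge0 (I : operator) D u : Prop :=
  usc_on (closure D) u /\
  forall x N phi, D x -> open N -> N x -> N `<=` D -> C2_on N phi ->
    phi x = u x -> (forall y, N y -> y != x -> u y < phi y) ->
    (0 <= I (patch u N phi) x)%E.

Definition visc_le0 (I : operator) D u : Prop :=
  lsc_on (closure D) u /\
  forall x N phi, D x -> open N -> N x -> N `<=` D -> C2_on N phi ->
    phi x = u x -> (forall y, N y -> y != x -> phi y < u y) ->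
    (I (patch u N phi) x <= 0)%E.

Definition sup_norm u : R := sup [set `|u x| | x in [set: 'rV[R]_d]].

Definition holder_seminorm (alpha : R) A u : \bar R :=
  ereal_sup [set (`|u p.1 - u p.2| / enorm (p.1 - p.2) `^ alpha)%:E |
    p in [set p : 'rV[R]_d * 'rV[R]_d | [/\ A p.1, A p.2 & p.1 != p.2]]].

(* cls J is the class of operators attached to J.  All of f, J, z0, r and u are
   quantified here, after alpha and C; the only information on them that alpha
   and C may use is given by the real parameters. *)
Definition holder_estimate (r0 M0 a1 a2 delta1 delta2 f0 : R)
    (cls : ('rV[R]_d -> 'rV[R]_d -> R) -> set operator) (alpha C : R) : Prop :=
  forall (f : R -> R) J,
    admissible_profile r0 a1 a2 delta1 delta2 f -> f r0^-1 = f0 ->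
    admissible_kernel r0 M0 f J ->
  forall z0 (r : R) u, 0 < r ->
    bounded_fun u -> measurable_fun [set: 'rV[R]_d] u ->
    visc_ge0 (Mplus (cls J)) (eball z0 r) u ->
    visc_le0 (Mminus (cls J)) (eball z0 r) u ->
  (holder_seminorm alpha (eball z0 (r / 2)) u <=
   (C * (1 / Num.min r r0) `^ alpha * sup_norm u)%:E)%E.

End nonlocal_operators.

(* Main.v *)
From HB Require Import structures.
Require Import Defs.
From mathcomp Require Import all_boot all_order all_algebra.
From mathcomp Require Import all_classical all_reals all_analysis.
From mathcomp Require Import measurable_realfun ring lra.

Set Implicit Arguments.
Unset Strict Implicit.
Unset Printing Implicit Defensive.

Import Order.TTheory GRing.Theory Num.Theory.
Import numFieldNormedType.Exports.

Local Open Scope classical_set_scope.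
Local Open Scope ring_scope.

(** Diminish of oscillation, in the style of Silvestre. At scale rho the two
natural sizes are f (1 / rho), the rate of jumps of length about rho, and the
density f (1 / rho) / rho ^ d of the kernel at that distance. The two power
bounds on f make every moment of the kernel comparable with its value at the
relevant scale: far away the mass is at most T f (1 / s) ([far_mass]), near the
diagonal the second moment is at most C s^2 f (1 / s) ([near_moment]). Both come
from comparing a shell with its dilate by a factor theta chosen so large that
the moments of successive shells decrease geometrically.

The only further cost of a test function with gradient p at x is the drift, the
integral of p . (y - x) against the difference between the cut-off at the
current scale and the cut-off of the operator. It is at most C |p| s f (1 / s)
in each of the three situations of the theorem: if delta2 < 1 there is no
compensator and the first moment near x converges
([drift_bounded_low_order]); if delta1 > 1 the first moment away from x
converges ([drift_bounded_high_order]); if the kernel is symmetric around x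
the drift vanishes ([drift_bounded_symmetric]). From there on the three cases
are the same.

The heart is [diminish_above]. Suppose w <= m on a ball of radius rho, w is at
most m - h on half of a small concentric cube, and the part of w above m far
away is negligible. If w came too close to m near the center, then w minus a
small multiple of the squared distance to the center would have an interior
maximum x, so a paraboloid touches w from above at x. Testing the
equation there, the half cube where w is low contributes at most
- h kappa f (1 / rho) / 4, whereas the paraboloid, the drift and the tail only
cost a small multiple of h f (1 / rho): the operator is negative at x, a
contradiction. Hence w <= m - gamma h on the ball of radius rho / 4.

A function which is both a subsolution and a supersolution is either low or
high on half of the cube, so its oscillation shrinks by a factor q < 1 from one
scale to the next ([trapped_step]). The far part stays negligible along the
iteration because passing from rho to rho / theta at least doubles f (1 / rho)
while q is close to 1 ([excess_step]). Geometric decay of the oscillation around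
every point is a Hoelder estimate ([decay_holder]). *)

(** * Euclidean norm *)

Section euclidean_norm.
Context {R : realType} {d : nat}.
Implicit Types (x y z p : 'rV[R]_d).

Lemma edotC x y : edot x y = edot y x.
Proof. by apply: eq_bigr => i _; rewrite mulrC. Qed.

Lemma edotDl x y z : edot (x + y) z = edot x z + edot y z.
Proof. by rewrite -big_split; apply: eq_bigr => i _; rewrite mxE mulrDl. Qed.

Lemma edotZl a x y : edot (a *: x) y = a * edot x y.
Proof. by rewrite mulr_sumr; apply: eq_bigr => i _; rewrite mxE mulrA. Qed.

Lemma edotDr x y z : edot z (x + y) = edot z x + edot z y.
Proof. by rewrite edotC edotDl !(edotC z). Qed.

Lemma edotZr a x y : edot x (a *: y) = a * edot x y.
Proof. by rewrite edotC edotZl edotC. Qed.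

Lemma edot_sqrD x y : edot (x + y) (x + y) = edot x x + 2 * edot x y + edot y y.
Proof. by rewrite edotDl !edotDr (edotC y x); ring. Qed.

Lemma edotNl x y : edot (- x) y = - edot x y.
Proof. by rewrite -scaleN1r edotZl mulN1r. Qed.

Lemma edotNr x y : edot x (- y) = - edot x y.
Proof. by rewrite edotC edotNl edotC. Qed.

Lemma edot0r x : edot x 0 = 0.
Proof. by rewrite -(scale0r 0) edotZr mul0r. Qed.

Lemma edot_deltar x i : edot x (delta_mx ord0 i) = x ord0 i.
Proof.
rewrite /edot (bigD1 i)//= mxE !eqxx mulr1 big1 ?addr0// => j ji.
by rewrite mxE (negbTE ji) andbF mulr0.
Qed.

Lemma edot_ge0 x : 0 <= edot x x.
Proof. by apply: sumr_ge0 => i _; rewrite -expr2 sqr_ge0. Qed.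

Lemma sqr_coord_le x i : (x ord0 i) ^+ 2 <= edot x x.
Proof.
rewrite /edot (bigD1 i)//= -expr2 lerDl.
by apply: sumr_ge0 => j _; rewrite -expr2 sqr_ge0.
Qed.

Lemma edot_eq0 x : edot x x = 0 -> x = 0.
Proof.
move=> x0; apply/rowP => i; rewrite mxE; apply/eqP.
by rewrite -sqrf_eq0 eq_le sqr_ge0 -x0 sqr_coord_le.
Qed.

Lemma enorm_ge0 x : 0 <= enorm x.
Proof. exact: sqrtr_ge0. Qed.

Lemma enorm_sqr x : enorm x ^+ 2 = edot x x.
Proof. by rewrite sqr_sqrtr// edot_ge0. Qed.

(** Cauchy-Schwarz, from the nonnegativity of the squared norm of
|y|^2 x - (x . y) y. *)
Lemma edot_sqr_le x y : edot x y ^+ 2 <= edot x x * edot y y.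
Proof.
have := edot_ge0 y; rewrite le_eqVlt => /predU1P[/esym y0|y0].
  by rewrite (edot_eq0 y0) !edot0r expr0n mulr0.
have := edot_ge0 (edot y y *: x - edot x y *: y).
rewrite edotDl !edotDr !edotNl !edotNr !edotZl !edotZr (edotC y x).
rewrite (_ : _ + _ = edot y y * (edot x x * edot y y - edot x y ^+ 2)).
  by rewrite pmulr_rge0// subr_ge0.
by ring.
Qed.

Lemma edot_le x y : `|edot x y| <= enorm x * enorm y.
Proof.
rewrite -ler_sqr ?nnegrE ?mulr_ge0 ?enorm_ge0//.
by rewrite real_normK ?num_real// exprMn !enorm_sqr edot_sqr_le.
Qed.

Lemma enormD x y : enorm (x + y) <= enorm x + enorm y.
Proof.
rewrite -ler_sqr ?nnegrE ?addr_ge0 ?enorm_ge0//.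
rewrite sqrrD !enorm_sqr edotDl !edotDr (edotC y x) mulr2n.
by have := edot_le x y; have := ler_norm (edot x y); lra.
Qed.

Lemma enormN x : enorm (- x) = enorm x.
Proof. by rewrite /enorm edotNl edotNr opprK. Qed.

Lemma enormC x y : enorm (x - y) = enorm (y - x).
Proof. by rewrite -enormN opprB. Qed.

Lemma enormB x y z : enorm (x - z) <= enorm (x - y) + enorm (y - z).
Proof. by have := enormD (x - y) (y - z); rewrite addrA subrK. Qed.

Lemma enorm0 : enorm (0 : 'rV[R]_d) = 0.
Proof. by rewrite /enorm edot0r sqrtr0. Qed.

Lemma enormxx x : enorm (x - x) = 0.
Proof. by rewrite subrr enorm0. Qed.

Lemma enorm_gt0 x y : (0 < enorm (x - y)) = (x != y).
Proof.
rewrite lt_neqAle enorm_ge0 andbT eq_sym; congr (~~ _); apply/eqP/eqP.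
  move=> xy; apply/eqP; rewrite -subr_eq0; apply/eqP/edot_eq0.
  by rewrite -enorm_sqr xy expr0n.
by move=> ->; rewrite enormxx.
Qed.

Lemma coord_le_enorm x i : `|x ord0 i| <= enorm x.
Proof.
rewrite -ler_sqr ?nnegrE ?enorm_ge0//.
by rewrite real_normK ?num_real// enorm_sqr sqr_coord_le.
Qed.

Lemma enorm_le_sum x : enorm x <= \sum_i `|x ord0 i|.
Proof.
have -> : x = \sum_i x ord0 i *: delta_mx ord0 i by rewrite -row_sum_delta.
rewrite (_ : \sum_i `|_| = \sum_i `|x ord0 i|); last first.
  by apply: eq_bigr => i _; rewrite -row_sum_delta.
elim/big_ind2 : _ => [|a s b t sa tb|i _].
- by rewrite enorm0.
- by rewrite (le_trans (enormD _ _))// lerD.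
- rewrite /enorm edotZl edotZr edot_deltar mxE !eqxx mulr1 -expr2.
  by rewrite sqrtr_sqr.
Qed.

Lemma edot_continuous (g h : 'rV[R]_d -> 'rV[R]_d) :
  (forall i, continuous (fun y => g y ord0 i)) ->
  (forall i, continuous (fun y => h y ord0 i)) ->
  continuous (fun y => edot (g y) (h y)).
Proof.
move=> cg ch; apply: continuous_big; first exact: add_continuous.
by move=> i _ x; exact: (cvgM (cg i x) (ch i x)).
Qed.

Lemma coordB_continuous z (i : 'I_d) :
  continuous (fun y : 'rV[R]_d => (y - z) ord0 i).
Proof.
move=> x; rewrite /continuous_at mxE.
rewrite (_ : (fun _ => _) = (fun y => y ord0 i + (- z) ord0 i)); last first.
  by apply/funext => y; rewrite mxE.
have h := @coord_continuous R 1 d ord0 i x.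
exact: (@cvgD R R _ _ _ _ (fun _ => (-z) ord0 i) _ _ h (cvg_cst _)).
Qed.

Lemma enorm_continuous z : continuous (fun y => enorm (y - z)).
Proof.
move=> x; apply: (@continuous_comp _ _ _ (fun y => edot (y - z) (y - z)) Num.sqrt).
  by apply: edot_continuous => i; exact: coordB_continuous.
exact: sqrt_continuous.
Qed.

Lemma eball_open z r : open (eball z r).
Proof.
rewrite (_ : eball z r = (fun y => enorm (y - z)) @^-1` [set t | t < r])//.
by apply: open_comp; [move=> + _; exact: enorm_continuous|exact: open_lt].
Qed.

Definition ecball z (r : R) : set 'rV[R]_d := [set x | enorm (x - z) <= r].

Lemma ecball_compact z r : compact (ecball z r).
Proof.
apply: bounded_closed_compact.
- exists (`|z| + `|r|); split => // M zM x /= xz.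
  rewrite /Num.norm/= mx_normrE; apply: bigmax_le => [|[i j] _ /=].
    by rewrite (le_trans _ (ltW zM)).
  rewrite ord1 (le_trans _ (ltW zM))//.
  rewrite -(subrK z x) mxE (le_trans (ler_normD _ _))// addrC lerD//.
    by rewrite /Num.norm/= mx_normrE (le_bigmax _ _ (ord0, j)).
  by rewrite (le_trans (coord_le_enorm _ _))// (le_trans xz)// ler_norm.
- rewrite (_ : ecball z r = (fun y => enorm (y - z)) @^-1` [set t | t <= r])//.
  by apply: closed_comp; [move=> + _; exact: enorm_continuous|exact: closed_le].
Qed.

End euclidean_norm.

(** * Paraboloids and maxima of semicontinuous functions *)

Section test_functions.
Context {R : realType} {d : nat}.
Implicit Types (x y z p : 'rV[R]_d) (w : 'rV[R]_d -> R).

(** Along every line a quadratic function is a polynomial of degree two, which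
makes its derivatives computable without the calculus of differentials. *)
Lemma is_derive_polynomial (g : 'rV[R]_d -> R) y v l m :
  (forall h, g (h *: v + y) = g y + h * l + h ^+ 2 * m) ->
  is_derive y v g l.
Proof.
move=> gE.
have cv : h^-1 *: (g (h *: v + y) - g y) @[h --> 0^'] --> l.
  have h0 : l + h * m @[h --> (0:R)^'] --> l.
    rewrite -[X in _ --> X]addr0 -[X in _ --> _ + X](mul0r m).
    apply: cvg_within_filter.
    apply: cvgD; first exact: cvg_cst.
    by apply: cvgM; [exact: cvg_id|exact: cvg_cst].
  apply: cvg_trans h0; apply: near_eq_cvg; near=> h.
  have h0 : h != 0 by near: h; exact: nbhs_dnbhs_neq.
  rewrite gE /GRing.scale/=; field.
  exact: h0.
apply: DeriveDef.
- by apply/cvg_ex; exists l.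
- exact: cvg_lim.
Unshelve. all: by end_near. Qed.

Definition quad x (c : R) p b y : R := c + edot p (y - x) + b * edot (y - x) (y - x).

Lemma quadxx x c p b : quad x c p b x = c.
Proof. by rewrite /quad subrr !edot0r mulr0 !addr0. Qed.

Lemma quad_continuous x c p b : continuous (quad x c p b).
Proof.
have h1 : continuous (fun y => edot p (y - x)).
  apply: edot_continuous => i; first exact: cst_continuous.
  exact: coordB_continuous.
have h2 : continuous (fun y => edot (y - x) (y - x)).
  by apply: edot_continuous => i; exact: coordB_continuous.
move=> y.
exact: (cvgD (cvgD (cvg_cst c) (h1 y)) (cvgM (cvg_cst b) (h2 y))).
Qed.

Lemma is_derive_quad x c p b i y :
  is_derive y (delta_mx ord0 i) (quad x c p b)
    (p ord0 i + 2 * b * (y - x) ord0 i).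
Proof.
apply: (@is_derive_polynomial _ _ _ _ b) => h; rewrite /quad.
rewrite -(addrA (h *: _)).
rewrite !edotDr !edotDl !edotZr !edotZl.
rewrite (edotC (delta_mx ord0 i) y) (edotC (delta_mx ord0 i) (- x)).
by rewrite !edot_deltar !mxE !eqxx/=; ring.
Qed.

Lemma partial_quad x c p b i :
  partial i (quad x c p b) = fun y => p ord0 i + 2 * b * (y - x) ord0 i.
Proof. by apply/funext => y; have [_] := is_derive_quad x c p b i y. Qed.

Lemma grad_quad x c p b : grad (quad x c p b) x = p.
Proof. by apply/rowP => i; rewrite mxE partial_quad subrr !mxE mulr0 addr0. Qed.

Lemma C2_quad N x c p b : C2_on N (quad x c p b).
Proof.
have cp i : continuous (partial i (quad x c p b)).
  rewrite partial_quad => y.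
  have h := @coordB_continuous R d x i y.
  exact: (cvgD (cvg_cst _) (cvgM (cvg_cst _) h)).
have dp i j y : is_derive y (delta_mx ord0 j) (partial i (quad x c p b))
    (2 * b * (delta_mx ord0 j : 'rV_d) ord0 i).
  rewrite partial_quad; apply: (@is_derive_polynomial _ _ _ _ 0) => h.
  by rewrite !mxE; ring.
split=> [|i]; split.
- by move=> y _; exact: quad_continuous.
- by move=> i; split=> y _; [have [] := is_derive_quad x c p b i y|exact: cp].
- by move=> y _; exact: cp.
- move=> j; split=> y _; first by have [] := dp i j y.
  rewrite (_ : partial j _ = cst (2 * b * (delta_mx ord0 j : 'rV_d) ord0 i)).
    exact: cst_continuous.
  by apply/funext => t; have [_] := dp i j t.
Qed.

(** Upper semicontinuity at the points of A, with neighbourhoods taken in A and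
spelled out so that no topology on a subtype is involved. *)
Definition usc_within (A : set 'rV[R]_d) w := forall x a, A x -> w x < a ->
  exists2 V, nbhs x V & forall y, V y -> A y -> w y < a.

Lemma usc_on_within (A : set 'rV[R]_d) w : usc_on A w -> usc_within A w.
Proof.
move=> uw x a Ax wa.
have [|V /= xV Vw] := uw x (- a); first by rewrite lte_fin ltrN2.
exists [set y | A y -> V y]; last first.
  by move=> y AV Ay; have := Vw _ (AV Ay); rewrite lte_fin ltrN2.
by move: xV; rewrite /nbhs/= -nbhs_subspace_in.
Qed.

Lemma usc_within_sub (A B : set 'rV[R]_d) w :
  A `<=` B -> usc_within B w -> usc_within A w.
Proof.
move=> AB uw x a Ax wa; have [V xV Vw] := uw x a (AB _ Ax) wa.
by exists V => // y Vy Ay; apply: Vw => //; exact: AB.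
Qed.

Lemma usc_within_sub_continuous (A : set 'rV[R]_d) w g :
  usc_within A w -> continuous g -> usc_within A (fun y => w y - g y).
Proof.
move=> uw cg x a Ax wa; pose e := (a - (w x - g x)) / 2.
have e0 : 0 < e by rewrite divr_gt0// subr_gt0.
have [V xV Vw] := uw x (w x + e) Ax ltac:(by rewrite ltrDl).
exists (V `&` [set y | `|g x - g y| < e]).
  apply: filterI => //.
  by have /cvgrPdist_lt := cg x; apply.
move=> y [Vy gy] Ay; have := Vw y Vy Ay; move: gy; rewrite /= ltr_norml /e.
lra.
Qed.

(** The superlevel sets above sup w - e form a filter on the compact set A; at
a cluster point of this filter semicontinuity forbids a value below the
supremum. *)
Lemma usc_attains_max (A : set 'rV[R]_d) w (B : R) :
  compact A -> usc_within A w -> (forall y, A y -> w y <= B) -> A !=set0 ->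
  exists2 x, A x & forall y, A y -> w y <= w x.
Proof.
move=> cA uw wB [a0 Aa0].
pose W := [set w y | y in A].
have W0 : has_sup W.
  by split; [exists (w a0), a0|exists B => _ [y Ay <-]; exact: wB].
pose F := filter_from [set e : R | 0 < e] (fun e => A `&` [set y | sup W - e < w y]).
have FF : ProperFilter F.
  apply: filter_from_proper.
    apply: filter_from_filter; first by exists 1 => /=.
    move=> e f e0 f0; exists (Num.min e f) => /=; first by rewrite lt_min e0.
    move=> y [Ay] /=; move=> yw.
    have [me mf] : Num.min e f <= e /\ Num.min e f <= f.
      by rewrite !ge_min !lexx orbT.
    by split; split => //=; lra.
  move=> e e0; have [_ [y Ay <-] ye] := sup_adherent e0 W0.
  by exists y.
have [|p [Ap clp]] := cA F FF.
  by exists 1 => //= y [].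
exists p => // y Ay; rewrite leNgt; apply/negP => py.
have yS : w y <= sup W by apply: ub_le_sup; [exact: W0.2|exists y].
pose e := (w y - w p) / 2; have e0 : 0 < e by rewrite divr_gt0 ?subr_gt0.
have [V pV Vw] := uw p (w p + e) Ap ltac:(by rewrite ltrDl).
have [||t [[At /= tS] Vt]] := clp (A `&` [set y | sup W - e < w y]) V.
- by exists e.
- exact: pV.
- by have := Vw t Vt At; rewrite /e in tS *; lra.
Qed.

End test_functions.

(** * Lebesgue measure on balls, cubes and under reflections *)

Section measurability.
Context {R : realType} {d : nat}.
Implicit Types (x y z p : 'rV[R]_d).

Lemma measurable_coordB z (i : 'I_d) :
  measurable_fun setT (fun y : 'rV[R]_d => (y - z) ord0 i).
Proof.
rewrite (_ : (fun _ => _) = (fun y : 'rV[R]_d => y ord0 i - z ord0 i)).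
  apply: measurable_funB; last exact: measurable_cst.
  exact: measurable_coord.
by apply/funext => y; rewrite !mxE.
Qed.

Lemma measurable_edotB p z : measurable_fun setT (fun y => edot p (y - z)).
Proof.
apply: measurable_sum => i; apply: measurable_funM; first exact: measurable_cst.
exact: measurable_coordB.
Qed.

Lemma measurable_enormB z : measurable_fun setT (fun y => enorm (y - z)).
Proof.
apply: (measurableT_comp (continuous_measurable_fun (@sqrt_continuous R))).
by apply: measurable_sum => i; apply: measurable_funM; exact: measurable_coordB.
Qed.

Definition shell x a b := [set y : 'rV[R]_d | a <= enorm (y - x) < b].
Definition far x a := [set y : 'rV[R]_d | a <= enorm (y - x)].

Lemma measurable_shell x a b : measurable (shell x a b).
Proof.
rewrite (_ : shell x a b = setT `&` (fun y => enorm (y - x)) @^-1` `[a, b[).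
  by apply: measurable_enormB => //; exact: measurable_itv.
by rewrite setTI; apply/seteqP; split=> y /=; rewrite in_itv.
Qed.

Lemma measurable_far x a : measurable (far x a).
Proof.
rewrite (_ : far x a = setT `&` (fun y => enorm (y - x)) @^-1` `[a, +oo[).
  by apply: measurable_enormB => //; exact: measurable_itv.
by rewrite setTI; apply/seteqP; split=> y /=; rewrite in_itv /= andbT.
Qed.

Lemma measurable_eball x a : measurable (eball x a).
Proof.
rewrite (_ : eball x a = setT `&` (fun y => enorm (y - x)) @^-1` `]-oo, a[).
  by apply: measurable_enormB => //; exact: measurable_itv.
by rewrite setTI; apply/seteqP; split=> y /=; rewrite in_itv.
Qed.

Definition cube x b :=
  [set y : 'rV[R]_d | forall i, `]x ord0 i - b, x ord0 i + b[%classic (y ord0 i)].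

Lemma measurable_cube x b : measurable (cube x b).
Proof.
rewrite (_ : cube x b = \bigcap_(i in setT)
    ((fun y : 'rV[R]_d => y ord0 i) @^-1` `]x ord0 i - b, x ord0 i + b[)).
  apply: fin_bigcap_measurable => [|i _]; first exact: finite_finset.
  rewrite -[X in measurable X]setTI.
  by apply: (measurable_coord i measurableT); exact: measurable_itv.
by apply/seteqP; split => y /= h i; [move=> _; exact: h|exact: (h i I)].
Qed.

Lemma lebesgue_cube x b : 0 < b -> lebesgue_rV d (cube x b) = ((2 * b) ^+ d)%:E.
Proof.
move=> b0.
rewrite (@lebesgue_rV_box _ _ (fun i => `]x ord0 i - b, x ord0 i + b[%classic)); last first.
  by move=> i; exact: measurable_itv.
rewrite (eq_bigr (fun=> (2 * b)%:E)) => [|i _]; last first.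
  rewrite lebesgue_measure_itv/= lte_fin ifT; last by lra.
  by rewrite -EFinB; congr EFin; lra.
by rewrite prodEFin prodr_const card_ord.
Qed.

Lemma eball_sub_cube x b : eball x b `<=` cube x b.
Proof.
move=> y /= xy i; have := le_lt_trans (coord_le_enorm (y - x) i) xy.
by rewrite !mxE ltr_norml /= in_itv/=; lra.
Qed.

Lemma lebesgue_eball_le x b : 0 < b -> (lebesgue_rV d (eball x b) <= ((2 * b) ^+ d)%:E)%E.
Proof.
move=> b0; rewrite -(lebesgue_cube x b0); apply: le_measure; rewrite ?inE.
- exact: measurable_eball.
- exact: measurable_cube.
- exact: eball_sub_cube.
Qed.

Lemma cube_sub_eball x b : (0 < d)%N -> cube x b `<=` eball x (d%:R * b).
Proof.
move=> d0 y xy; rewrite /eball/= (le_lt_trans (enorm_le_sum _))//.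
have h : (forall i, `|(y - x) ord0 i| < b).
  by move=> i; have := xy i; rewrite /= in_itv/= !mxE ltr_norml; lra.
rewrite (_ : d%:R * b = \sum_(i < d) b); last by rewrite sumr_const card_ord mulr_natl.
by apply: ltr_sum => //; apply/hasP; exists (Ordinal d0) => //; rewrite mem_index_enum.
Qed.

Lemma measurable_offdiag_set :
  measurable [set p : 'rV[R]_d * 'rV[R]_d | p.1 != p.2].
Proof.
pose g (i : 'I_d) (p : 'rV[R]_d * 'rV[R]_d) := p.1 ord0 i - p.2 ord0 i.
have mg i : measurable_fun setT (g i).
  apply: measurable_funB.
    exact: (measurableT_comp (measurable_coord i) measurable_fst).
  exact: (measurableT_comp (measurable_coord i) measurable_snd).
rewrite (_ : mkset _ = \bigcup_(i in [set: 'I_d]) (setT `&` g i @^-1` (~` [set 0]))).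
  apply: fin_bigcup_measurable => [|i _]; first exact: finite_finset.
  by apply: mg => //; apply: measurableC; exact: measurable_set1.
apply/seteqP; split => [[y z]/= yz|[y z] [i _ [_]]] /=.
  apply: contrapT => h; move/eqP: yz; apply; apply/rowP => i.
  apply: contrapT => yzi; apply: h; exists i => //; split => //.
  by rewrite /g/= => /eqP; rewrite subr_eq0 => /eqP.
by rewrite /g/=; apply: contra_notN => /eqP ->; rewrite subrr.
Qed.

(** The kernels are only measurable off the diagonal, so a section is completed
by 0 at the pole. *)
Lemma measurable_section (K : 'rV[R]_d -> 'rV[R]_d -> R) x : measurable_offdiag K ->
  measurable_fun setT (fun y => if y == x then 0 else K x y).
Proof.
move=> mK; apply: measurable_fun_if => //.
- rewrite (_ : (fun _ => _) = (fun y => enorm (y - x) <= 0)).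
    by apply: measurable_fun_ler; [exact: measurable_enormB|exact: measurable_cst].
  by apply/funext => y; rewrite leNgt enorm_gt0 negbK.
- rewrite setTI.
  move=> _ Y mY.
  have /(_ measurableT) := @measurable_fun_pair _ _ _ _ _ _ (cst x) id
    (measurable_cst x) (@measurable_id _ 'rV[R]_d setT).
  move=> /(_ _ (mK measurable_offdiag_set Y mY)); rewrite setTI.
  congr measurable; apply/seteqP; split=> y /=.
    by rewrite eq_sym => -[/negbTE ->].
  by rewrite eq_sym => -[->].
Qed.

Lemma measurable_EFin_mul (h k : 'rV[R]_d -> R) D : measurable_fun setT h ->
  measurable_fun setT k -> measurable_fun D (fun y => (h y * k y)%:E).
Proof.
move=> mh mk; apply/measurable_EFinP.
by apply: measurable_funTS; exact: measurable_funM.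
Qed.

End measurability.

Section reflection.
Context {R : realType}.

Lemma lebesgue_measure_reflect (c : R) (A : set (measurableTypeR R)) :
  measurable A ->
  lebesgue_measure ((fun t : measurableTypeR R => c - t : measurableTypeR R) @^-1` A) =
  lebesgue_measure A.
Proof.
move=> mA; have mr : measurable_fun setT (fun t : measurableTypeR R => c - t : measurableTypeR R).
  by apply: measurable_funB => //; exact: measurable_cst.
pose r : {mfun measurableTypeR R >-> measurableTypeR R} :=
  HB.pack (fun t : measurableTypeR R => c - t : measurableTypeR R)
   (isMeasurableFun.Build _ _ _ _ _ mr).
have -> : lebesgue_measure ((fun t : measurableTypeR R => c - t : measurableTypeR R) @^-1` A) =
  pushforward lebesgue_measure r A by [].
apply/esym/lebesgue_measure_unique => //= _ [[a b]] _ <-.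
rewrite /pushforward/= (_ : _ @^-1` _ = `[c - b, c - a[%classic).
  rewrite !lebesgue_measure_itv/= !lte_fin ltrD2l ltrN2.
  by case: ifP => // _; rewrite -!EFinB; congr EFin; ring.
by apply/seteqP; split=> t /=; rewrite !in_itv/=; lra.
Qed.

Definition reflect d (x y : 'rV[R]_d) : 'rV[R]_d := x - y.

Lemma measurable_reflect d (x : 'rV[R]_d) : measurable_fun setT (reflect x).
Proof.
apply: measurable_fun_rV => i.
rewrite (_ : (fun _ => _) = (fun y : 'rV[R]_d => x ord0 i - y ord0 i)).
  by apply: measurable_funB; [exact: measurable_cst|exact: measurable_coord].
by apply/funext => y; rewrite !mxE.
Qed.

(** By induction on the dimension: a product measure is determined by its values
on rectangles, and on these the invariance is that of the two factors. *)
Lemma lebesgue_rV_reflect d (x : 'rV[R]_d) (A : set 'rV[R]_d) : measurable A ->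
  lebesgue_rV d (reflect x @^-1` A) = lebesgue_rV d A.
Proof.
elim: d x A => [|d IH] x A mA.
  rewrite (_ : reflect x @^-1` A = A)//.
  by apply/funext => y; congr (A _); apply/rowP => -[].
pose l : {sigma_finite_measure set (measurableTypeR R) -> \bar R} := lebesgue_measure.
pose mu := @lebesgue_rV R d.
pose x' : 'rV[R]_d := \row_i x ord0 (lift ord0 i).
pose rr (p : measurableTypeR R * 'rV[R]_d) : measurableTypeR R * 'rV[R]_d :=
  (x ord0 ord0 - p.1, reflect x' p.2).
have mr : measurable_fun setT rr.
  apply/measurable_fun_pairP; split.
    apply: measurable_funB; first exact: measurable_cst.
    exact: measurable_fst.
  exact: (measurableT_comp (measurable_reflect x') measurable_snd).
pose rrm : {mfun (measurableTypeR R * 'rV[R]_d)%type >->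
    (measurableTypeR R * 'rV[R]_d)%type} := HB.pack rr
   (isMeasurableFun.Build _ _ _ _ _ mr).
have mC : measurable (@cons_rV R d @^-1` A).
  by rewrite -[X in measurable X]setTI; exact: measurable_cons_rV.
have -> : lebesgue_rV d.+1 A = (l \x mu)%E (@cons_rV R d @^-1` A) by [].
have -> : lebesgue_rV d.+1 (reflect x @^-1` A) = pushforward (l \x mu)%E rrm (@cons_rV R d @^-1` A).
  rewrite /= /lebesgue_step /pushforward; congr (_ _).
  apply/funext => -[a y]; congr (A _).
  apply/rowP => i; rewrite !mxE/=; case: (unliftP ord0 i) => [j|] -> //=.
  by rewrite !mxE.
apply/esym; apply: product_measure_unique => // B C mB mC'.
rewrite [LHS](_ : _ = (l \x mu)%E (
   ((fun t : measurableTypeR R => x ord0 ord0 - t : measurableTypeR R) @^-1` B) `*`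
   (reflect x' @^-1` C)))//.
rewrite product_measure1E.
- by rewrite /l/= lebesgue_measure_reflect// [mu _]IH.
- rewrite -[X in measurable X]setTI.
  have m1 : measurable_fun setT (fun t : measurableTypeR R => x ord0 ord0 - t : measurableTypeR R).
    by apply: measurable_funB => //; exact: measurable_cst.
  exact: m1.
- by rewrite -[X in measurable X]setTI; exact: measurable_reflect.
Qed.

End reflection.

(** * Moments of the kernel at a given scale *)

Section scaling.
Context {R : realType}.

Lemma powR_large (c e B : R) : 0 < e -> exists2 t, B <= t & c <= t `^ e.
Proof.
move=> e0; pose b := Num.max c 1; pose t := Num.max B (b `^ e^-1).
have b0 : 0 < b by rewrite lt_max ltr01 orbT.
exists t; first by rewrite le_max lexx.
apply: (@le_trans _ _ b); first by rewrite le_max lexx.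
have -> : b = (b `^ e^-1) `^ e by rewrite -powRrM mulVf ?gt_eqF// powRr1// ltW.
have bt : b `^ e^-1 <= t by rewrite le_max lexx orbT.
by rewrite ge0_ler_powR ?nnegrE ?powR_ge0 ?(ltW e0)// (le_trans _ bt)// powR_ge0.
Qed.

Lemma expr_unbounded (c t : R) : 2 <= t -> exists n, c < t ^+ n.
Proof.
move=> t2; exists (Num.bound `|c|).
apply: (le_lt_trans (ler_norm c)).
apply: (lt_le_trans (archi_boundP (normr_ge0 c))).
apply: (@le_trans _ _ (2 ^+ Num.bound `|c|)).
  by rewrite -natrX ler_nat ltnW// ltn_expl.
by rewrite lerXn2r ?nnegrE//; lra.
Qed.

(** The factor for which the p-th moments of outward shells decrease
geometrically when p < delta1. *)
Lemma exists_expanding_scale (c delta : R) (p : nat) : p%:R < delta ->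
  exists2 t, 4 <= t & c * t ^+ p <= t `^ delta.
Proof.
move=> pd; rewrite -subr_gt0 in pd; have [t t4 ct] := powR_large c 4 pd.
exists t => //; have t0 : 0 < t by lra.
rewrite -[delta](subrK p%:R) powRD; last by rewrite (gt_eqF t0) implybT.
by rewrite powR_mulrn ?(ltW t0)// ler_wpM2r// exprn_ge0// ltW.
Qed.

(** The factor for which the p-th moments of inward shells decrease
geometrically when p > delta2. *)
Lemma exists_contracting_scale (c delta : R) (p : nat) : delta < p%:R ->
  exists2 t, 4 <= t & c * t `^ delta <= t ^+ p.
Proof.
move=> pd; rewrite -subr_gt0 in pd; have [t t4 ct] := powR_large c 4 pd.
exists t => //; have t0 : 0 < t by lra.
rewrite -powR_mulrn ?(ltW t0)// -[X in _ <= _ `^ X](subrK delta) powRD.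
  by rewrite ler_wpM2r// powR_ge0.
by rewrite (gt_eqF t0) implybT.
Qed.

Context (r0 a1 a2 delta1 delta2 : R) (f : R -> R).
Context (r0_gt0 : 0 < r0) (a1_gt0 : 0 < a1)
  (fP : admissible_profile r0 a1 a2 delta1 delta2 f).

(** Division by zero being zero, the lower bound with s = 1 excludes f t = 0. *)
Lemma profile_gt0 t : r0^-1 <= t -> 0 < f t.
Proof.
case: fP => f0 _ fg rt; rewrite lt_neqAle f0 ?andbT; last first.
  by rewrite (le_trans _ rt)// invr_ge0 ltW.
apply/eqP => ft0; have /andP[+ _] := fg 1 t (lexx _) rt.
by rewrite -ft0 invr0 mulr0 powR1 mulr1 leNgt a1_gt0.
Qed.

Lemma profile_ge s t : 1 <= s -> r0^-1 <= t -> a1 * s `^ delta1 * f t <= f (s * t).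
Proof.
move=> s1 rt; case: fP => _ _ /(_ s t s1 rt) /andP[+ _].
by rewrite ler_pdivlMr// profile_gt0.
Qed.

Lemma profile_le s t : 1 <= s -> r0^-1 <= t -> f (s * t) <= a2 * s `^ delta2 * f t.
Proof.
move=> s1 rt; case: fP => _ _ /(_ s t s1 rt) /andP[_].
by rewrite ler_pdivrMr// profile_gt0.
Qed.

Lemma profile_mono s t : 0 < s -> s <= t -> f t^-1 <= f s^-1.
Proof.
move=> s0 st; case: fP => _ fm _; apply: fm; first by rewrite invr_ge0 (le_trans (ltW s0)).
by rewrite lef_pV2// posrE (lt_le_trans s0).
Qed.

Lemma profileV_gt0 s : 0 < s -> s <= r0 -> 0 < f s^-1.
Proof. by move=> s0 sr; rewrite profile_gt0// lef_pV2 ?posrE. Qed.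

Lemma profileV_ge t s : 1 <= t -> 0 < s -> s <= r0 ->
  a1 * t `^ delta1 * f s^-1 <= f (s / t)^-1.
Proof.
move=> t1 s0 sr; rewrite invf_div; apply: profile_ge => //.
by rewrite lef_pV2 ?posrE.
Qed.

Lemma profileV_le t s : 1 <= t -> 0 < s -> s <= r0 ->
  f (s / t)^-1 <= a2 * t `^ delta2 * f s^-1.
Proof.
move=> t1 s0 sr; rewrite invf_div; apply: profile_le => //.
by rewrite lef_pV2 ?posrE.
Qed.

End scaling.

Section moments.
Context {R : realType} {d : nat}.
Implicit Types (x y : 'rV[R]_d) (k : 'rV[R]_d -> R) (A : set 'rV[R]_d).

(** What is used of a kernel K in the class, once the pole x is frozen and k is
the section K x. *)
Definition kernel_at (r0 lam Lam M : R) (f : R -> R) x k : Prop :=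
  [/\ measurable_fun setT k, forall y, 0 <= k y,
      forall y, 0 < enorm (y - x) < r0 ->
        lam * (f (enorm (y - x))^-1 / enorm (y - x) ^+ d) <= k y
        <= Lam * (f (enorm (y - x))^-1 / enorm (y - x) ^+ d) &
      (\int[lebesgue_rV d]_(y in far x r0) (k y)%:E <= M%:E)%E].

Definition moment x k p A : \bar R :=
  (\int[lebesgue_rV d]_(y in A) (enorm (y - x) ^+ p * k y)%:E)%E.

Context (r0 lam Lam M a1 a2 delta1 delta2 : R) (f : R -> R) (x : 'rV[R]_d) (k : 'rV[R]_d -> R).
Context (r0_gt0 : 0 < r0) (Lam_gt0 : 0 < Lam) (a1_gt0 : 0 < a1)
  (fP : admissible_profile r0 a1 a2 delta1 delta2 f)
  (kP : kernel_at r0 lam Lam M f x k).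

Let k_ge0 y : 0 <= k y. Proof. by case: kP. Qed.

Lemma moment_measurable p D : measurable_fun D (fun y => (enorm (y - x) ^+ p * k y)%:E).
Proof.
apply: measurable_EFin_mul; last by case: kP.
by apply: measurable_funX; exact: measurable_enormB.
Qed.

Let moment_fun_ge0 p y : (0 <= (enorm (y - x) ^+ p * k y)%:E)%E.
Proof. by rewrite lee_fin mulr_ge0// exprn_ge0// enorm_ge0. Qed.

Lemma moment_setU p A B : measurable A -> measurable B -> [disjoint A & B] ->
  moment x k p (A `|` B) = (moment x k p A + moment x k p B)%E.
Proof.
by move=> mA mB AB; apply: ge0_integral_setU => //; exact: moment_measurable.
Qed.

Lemma moment_shell p t a b : 0 < a -> a <= b -> b <= r0 -> b <= t * a ->
  (moment x k p (shell x a b) <=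
   (Lam * t ^+ p * (2 * t) ^+ d * (a ^+ p * f a^-1))%:E)%E.
Proof.
move=> a0 ab br bta; have b0 : 0 < b by exact: lt_le_trans ab.
have fa0 : 0 <= f a^-1 by rewrite ltW// (profileV_gt0 r0_gt0 a1_gt0 fP)// (le_trans ab).
pose c := (t * a) ^+ p * (Lam * (f a^-1 / a ^+ d)).
have ta0 : 0 <= t * a by rewrite (le_trans _ bta)// ltW.
have c0 : 0 <= c.
  by rewrite /c !mulr_ge0 ?exprn_ge0// ?invr_ge0 ?exprn_ge0 ?(ltW a0)// ltW.
apply: (@le_trans _ _ (\int[lebesgue_rV d]_(y in shell x a b) c%:E)%E).
  apply: ge0_le_integral => //.
  - exact: measurable_shell.
  - exact: moment_measurable.
  move=> y /andP[ay yb]; rewrite lee_fin /c ler_pM//.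
  - by rewrite exprn_ge0// enorm_ge0.
  - by rewrite lerXn2r ?nnegrE ?enorm_ge0// (le_trans (ltW yb)).
  have y0 : 0 < enorm (y - x) by exact: lt_le_trans ay.
  case: kP => _ _ /(_ y) + _.
  rewrite y0 (lt_le_trans yb br) => /(_ isT) /andP[_] /le_trans; apply.
  rewrite ler_pM2l// ler_pM//.
  - by case: fP => + _ _; apply; rewrite invr_ge0 enorm_ge0.
  - by rewrite invr_ge0 exprn_ge0 ?enorm_ge0.
  - exact: (profile_mono fP a0 ay).
  - by rewrite lef_pV2 ?posrE ?exprn_gt0// lerXn2r ?nnegrE ?enorm_ge0 ?(ltW a0).
rewrite integral_cst/=; last exact: measurable_shell.
apply: (@le_trans _ _ (c%:E * ((2 * (t * a)) ^+ d)%:E)%E).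
  rewrite lee_wpmul2l ?lee_fin//.
  apply: (@le_trans _ _ (lebesgue_rV d (eball x b))).
    apply: le_measure; rewrite ?inE; [exact: measurable_shell|exact: measurable_eball|].
    by move=> y /andP[].
  apply: (le_trans (lebesgue_eball_le _ b0)).
  by rewrite lee_fin; apply: lerXn2r; rewrite ?nnegrE; lra.
rewrite -EFinM lee_fin /c le_eqVlt; apply/orP; left; apply/eqP.
by rewrite !exprMn; field; rewrite expf_neq0// gt_eqF.
Qed.

(** Splitting off the shell between s and t s reduces the bound at s to the bound
at t s, and the condition on t makes the latter at most half of what is
needed at s. Finitely many steps lead beyond r0. *)
Lemma moment_tail p t : 2 <= t -> 2 * t ^+ p <= a1 * t `^ delta1 ->
  forall s, 0 < s -> s <= r0 ->
  (moment x k p (shell x s r0) <=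
   (2 * (Lam * t ^+ p * (2 * t) ^+ d) * (s ^+ p * f s^-1))%:E)%E.
Proof.
move=> t2 tp s s0 sr; set Cs := Lam * t ^+ p * (2 * t) ^+ d.
have t1 : 1 < t by lra.
have t0 : 0 < t by lra.
have Cs0 : 0 < Cs by rewrite /Cs !mulr_gt0// exprn_gt0// mulr_gt0.
have fs0 (u : R) : 0 < u -> u <= r0 -> 0 < f u^-1 by exact: (profileV_gt0 r0_gt0 a1_gt0 fP).
have [n ns] : exists n, r0 <= t ^+ n * s.
  have [n] := expr_unbounded (r0 / s) t2.
  by rewrite ltr_pdivrMr// => /ltW; exists n.
elim: n s s0 sr ns => [|n IH] s s0 sr ns.
  rewrite expr0 mul1r in ns.
  rewrite (_ : shell _ _ _ = set0) /moment ?integral_set0.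
    by rewrite lee_fin ltW//; apply: mulr_gt0; [exact: mulr_gt0|
      apply: mulr_gt0; [exact: exprn_gt0|exact: fs0]].
  apply/seteqP; split => y //= /andP[sy yr].
  by have := lt_le_trans yr (le_trans ns sy); rewrite ltxx.
have sp : 0 < s ^+ p * f s^-1 by rewrite mulr_gt0 ?exprn_gt0// fs0.
have [tsr|tsr] := leP r0 (t * s).
  apply: (le_trans (moment_shell p s0 sr (lexx _) tsr)).
  by rewrite lee_fin ler_pM2r// -/Cs; lra.
rewrite (_ : shell x s r0 = shell x s (t * s) `|` shell x (t * s) r0); last first.
  apply/seteqP; split => y /=; rewrite /shell/=.
    move=> /andP[sy yr]; have [ty|yt] := leP (t * s) (enorm (y - x)).
      by right; rewrite yr.
    by left; rewrite sy.
  case=> /andP[sy yr]; first by rewrite sy (lt_trans yr).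
  by rewrite yr (le_trans _ sy)// ler_peMl// ltW.
rewrite moment_setU; last 3 first.
- exact: measurable_shell.
- exact: measurable_shell.
- apply/disj_setPS => y /= [/andP[_ h1] /andP[h2 _]].
  by have := lt_le_trans h1 h2; rewrite ltxx.
have ts0 : 0 < t * s by rewrite mulr_gt0.
have h1 := moment_shell p s0 (ler_peMl (ltW s0) (ltW t1)) (ltW tsr) (lexx _).
have h2 := IH (t * s) ts0 (ltW tsr) ltac:(by rewrite mulrA -exprSr).
apply: (le_trans (leeD h1 h2)); rewrite -EFinD lee_fin -/Cs.
have := profileV_ge r0_gt0 a1_gt0 fP (ltW t1) ts0 (ltW tsr).
rewrite (_ : t * s / t = s); last by rewrite mulrC mulrA mulVf ?mul1r// gt_eqF.
move=> h3.
have h4 : 2 * t ^+ p * f (t * s)^-1 <= f s^-1.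
  by apply: le_trans h3; rewrite ler_pM2r// fs0// ltW.
rewrite exprMn.
have h5 : Cs * s ^+ p * (2 * t ^+ p * f (t * s)^-1) <= Cs * s ^+ p * f s^-1.
  by rewrite ler_pM2l// mulr_gt0// exprn_gt0.
lra.
Qed.

(** As for the tail, but inwards: the shells between s / t^n and s satisfy a bound
uniform in n, and monotone convergence gives the ball. A positive p makes the
integrand vanish at the pole. *)
Lemma moment_inner p t : (0 < p)%N -> 2 <= t -> 2 * a2 * t `^ delta2 <= t ^+ p ->
  forall s, 0 < s -> s <= r0 ->
  (moment x k p (eball x s) <=
   (Lam * t ^+ p * (2 * t) ^+ d * (s ^+ p * f s^-1))%:E)%E.
Proof.
move=> p0 t2 tp s s0 sr; set Cs := Lam * t ^+ p * (2 * t) ^+ d.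
have t1 : 1 < t by lra. have t0 : 0 < t by lra.
have Cs0 : 0 < Cs by rewrite /Cs !mulr_gt0// exprn_gt0// mulr_gt0.
have fs0 (u : R) : 0 < u -> u <= r0 -> 0 < f u^-1 by exact: (profileV_gt0 r0_gt0 a1_gt0 fP).
have half (u : R) : 0 < u -> u <= r0 ->
    2 * ((u / t) ^+ p * f (u / t)^-1) <= u ^+ p * f u^-1.
  move=> u0 ur.
  have h := profileV_le r0_gt0 a1_gt0 fP (ltW t1) u0 ur.
  have h2 : 2 * f (u / t)^-1 <= t ^+ p * f u^-1.
    have := fs0 u u0 ur; have := tp.
    move: h; set F := f u^-1; set X := t `^ delta2 => h tpX F0.
    have : 2 * a2 * X * F <= t ^+ p * F by rewrite ler_pM2r.
    lra.
  rewrite expr_div_n.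
  have c0 : 0 < u ^+ p / t ^+ p by rewrite divr_gt0 ?exprn_gt0.
  rewrite -(ler_pM2l c0) in h2.
  rewrite [leRHS](_ : _ = u ^+ p / t ^+ p * (t ^+ p * f u^-1)); first lra.
  by rewrite mulrA divfK// gt_eqF// exprn_gt0.
have shells (n : nat) (u : R) : 0 < u -> u <= r0 ->
    (moment x k p (shell x (u / t ^+ n)%R u) <= (Cs * (u ^+ p * f u^-1))%:E)%E.
  elim: n u => [|n IH] u u0 ur.
    rewrite expr0 divr1 (_ : shell _ _ _ = set0) /moment ?integral_set0.
      by rewrite lee_fin ltW//; apply: mulr_gt0; [exact: Cs0|
      apply: mulr_gt0; [exact: exprn_gt0|exact: fs0]].
    by apply/seteqP; split => y //= /andP[/le_lt_trans h /h]; rewrite ltxx.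
  have ut0 : 0 < u / t by rewrite divr_gt0.
  have utu : u / t <= u by rewrite ler_pdivrMr// ler_peMr// ltW.
  have tn0 : 0 < t ^+ n by rewrite exprn_gt0.
  rewrite (_ : shell x _ u = shell x (u / t / t ^+ n) (u / t) `|` shell x (u / t) u); last first.
    have utn : u / t / t ^+ n <= u / t.
      by rewrite ler_pdivrMr// ler_peMr ?(ltW ut0)// exprn_ege1// ltW.
    rewrite exprS invfM mulrA; apply/seteqP; split => y /=; rewrite /shell/=.
      move=> /andP[sy yr]; have [ty|yt] := leP (u / t) (enorm (y - x)).
        by right; rewrite yr.
      by left; rewrite sy.
    case=> /andP[sy yr]; first by rewrite sy (lt_le_trans yr).
    by rewrite yr (le_trans utn).
  rewrite moment_setU; last 3 first.
  - exact: measurable_shell.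
  - exact: measurable_shell.
  - apply/disj_setPS => y /= [/andP[_ h1] /andP[h2 _]].
    by have := lt_le_trans h1 h2; rewrite ltxx.
  have h1 := IH (u / t) ut0 (le_trans utu ur).
  have h2 := moment_shell p (t := t) ut0 utu ur.
  apply: (le_trans (leeD h1 (h2 _))).
    by rewrite mulrC divfK// gt_eqF.
  rewrite -EFinD lee_fin -/Cs.
  have := half u u0 ur; set X := _ ^+ p * f (u / t)^-1; set Y := u ^+ p * _ => XY.
  have : Cs * (2 * X) <= Cs * Y by rewrite ler_pM2l.
  lra.
have -> : moment x k p (eball x s) = moment x k p (\bigcup_n shell x (s / t ^+ n) s).
  rewrite /moment integral_mkcond [RHS]integral_mkcond; apply: eq_integral => y _.
  rewrite !patchE; have [->|yx] := eqVneq y x.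
    by rewrite enormxx expr0n/= gtn_eqF// mul0r !if_same.
  congr (if _ then _ else _); apply/idP/idP; rewrite !inE.
    move=> ys; have yx0 : 0 < enorm (y - x) by rewrite enorm_gt0.
    have [n ns] := expr_unbounded (s / enorm (y - x)) t2.
    exists n => //; rewrite /shell/= ys andbT.
    by rewrite ler_pdivrMr ?exprn_gt0// mulrC -ler_pdivrMr// ltW.
  by move=> [n _ /andP[]].
have h : moment x k p (shell x (s / t ^+ n) s) @[n --> \oo] -->
    moment x k p (\bigcup_n shell x (s / t ^+ n) s).
  apply: ge0_nondecreasing_set_cvg_integral.
  - apply/nondecreasing_seqP => n; rewrite subsetEset => y /andP[sy ys].
    rewrite /shell/= ys andbT (le_trans _ sy)// exprSr invfM mulrA.
    rewrite ler_pdivrMr// ler_peMr// ?(ltW t1)//.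
    by rewrite divr_ge0// ?exprn_ge0// ltW.
  - by move=> n; exact: measurable_shell.
  - by move=> n; exact: moment_measurable.
  - by move=> n y _.
rewrite -(cvg_lim _ h)//; apply: lime_le; first by apply/cvg_ex; eexists; exact: h.
by near=> n; exact: shells.
Unshelve. all: by end_near. Qed.

End moments.

(** * Integrals against the kernel and the drift *)

Section weighted_integrals.
Context {R : realType} {d : nat}.
Implicit Types (k g h : 'rV[R]_d -> R) (A : set 'rV[R]_d) (c : R).

(** Integrability together with an upper bound of the integral, so that estimates
of the separate terms of a test function can be added as real inequalities. *)
Definition int_le k h c : Prop :=
  (lebesgue_rV d).-integrable setT (fun y => (h y * k y)%:E) /\
  (\int[lebesgue_rV d]_y (h y * k y)%:E <= c%:E)%E.

Lemma int_leD k g h a c : int_le k g a -> int_le k h c ->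
  int_le k (fun y => g y + h y) (a + c).
Proof.
move=> [ig ga] [ih hc].
have E : (fun y => ((g y + h y) * k y)%:E) =
    (fun y => (g y * k y)%:E + (h y * k y)%:E)%E.
  by apply/funext => y; rewrite mulrDl EFinD.
rewrite /int_le E; split; first exact: integrableD.
by rewrite integralD// EFinD leeD.
Qed.

Lemma int_leZ k h a c : 0 <= a -> int_le k h c ->
  int_le k (fun y => a * h y) (a * c).
Proof.
move=> a0 [ih hc].
have E : (fun y => ((a * h y) * k y)%:E) = (fun y => a%:E * (h y * k y)%:E)%E.
  by apply/funext => y; rewrite -mulrA EFinM.
rewrite /int_le E; split; first exact: integrableZl.
by rewrite integralZl// EFinM lee_wpmul2l.
Qed.

Lemma int_le_weaken k h a c : a <= c -> int_le k h a -> int_le k h c.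
Proof. by move=> ac [ih ha]; split => //; rewrite (le_trans ha)// lee_fin. Qed.

Lemma int_le_of_ge0 k h c : measurable_fun setT h -> measurable_fun setT k ->
  (forall y, 0 <= h y * k y) ->
  (\int[lebesgue_rV d]_y (h y * k y)%:E <= c%:E)%E -> int_le k h c.
Proof.
move=> mh mk hk0 hc; split => //; apply/integrableP; split.
  exact: measurable_EFin_mul.
under eq_integral do rewrite gee0_abs ?lee_fin//.
by rewrite (le_lt_trans hc)// ltry.
Qed.

Lemma int_le_mono k g h c : measurable_fun setT g -> measurable_fun setT k ->
  (forall y, 0 <= k y) -> (forall y, 0 <= g y <= h y) -> int_le k h c -> int_le k g c.
Proof.
move=> mg mk k0 gh [ih hc]; apply: int_le_of_ge0 => //.
  by move=> y; rewrite mulr_ge0//; case/andP: (gh y).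
apply: le_trans hc; apply: ge0_le_integral => //.
- by move=> y _; rewrite lee_fin mulr_ge0//; case/andP: (gh y).
- exact: measurable_EFin_mul.
- by case/integrableP: ih.
- by move=> y _; rewrite lee_fin ler_wpM2r//; case/andP: (gh y).
Qed.

Lemma int_le_abs k g h c : measurable_fun setT g -> measurable_fun setT k ->
  (forall y, 0 <= k y) -> (forall y, `|g y| <= h y) -> int_le k h c -> int_le k g c.
Proof.
move=> mg mk k0 gh [ih hc].
have ig : (lebesgue_rV d).-integrable setT (fun y => (g y * k y)%:E).
  apply: le_integrable ih => //; first exact: measurable_EFin_mul.
  move=> y _; rewrite !abse_EFin lee_fin !normrM ler_wpM2r//.
  by rewrite (le_trans (gh y))// ler_norm.
split => //; apply: le_trans hc; apply: le_integral => //.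
by move=> y _; rewrite lee_fin ler_wpM2r// (le_trans (ler_norm _)).
Qed.

Lemma integral_indic_mul k g A : measurable A ->
  (\int[lebesgue_rV d]_y (g y * \1_A y * k y)%:E =
   \int[lebesgue_rV d]_(y in A) (g y * k y)%:E)%E.
Proof.
move=> mA; rewrite [RHS]integral_mkcond; apply: eq_integral => y _.
by rewrite patchE indicE; case: ifP => _ /=; rewrite ?mulr1// mulr0 mul0r.
Qed.

Lemma int_le_indic k g A c : measurable A -> measurable_fun setT g ->
  measurable_fun setT k -> (forall y, 0 <= k y) -> (forall y, 0 <= g y) ->
  (\int[lebesgue_rV d]_(y in A) (g y * k y)%:E <= c%:E)%E ->
  int_le k (fun y => g y * \1_A y) c.
Proof.
move=> mA mg mk k0 g0 gc; apply: int_le_of_ge0 => //.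
- by apply: measurable_funM => //; exact: measurable_indic.
- by move=> y; rewrite !mulr_ge0.
- by rewrite integral_indic_mul.
Qed.

Lemma integral_indic k A : measurable A ->
  (\int[lebesgue_rV d]_y (\1_A y * k y)%:E =
   \int[lebesgue_rV d]_(y in A) (k y)%:E)%E.
Proof.
move=> mA; rewrite [RHS]integral_mkcond; apply: eq_integral => y _.
by rewrite patchE indicE; case: ifP => _ /=; rewrite ?mul1r// mul0r.
Qed.

(** A lower bound on the mass of A bounds the integral of the negative part of the
test function; the finite upper bound gives integrability. *)
Lemma int_leN_indic k A c a : measurable A -> measurable_fun setT k ->
  (forall y, 0 <= k y) ->
  (c%:E <= \int[lebesgue_rV d]_(y in A) (k y)%:E <= a%:E)%E ->
  int_le k (fun y => - \1_A y) (- c).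
Proof.
move=> mA mk k0 /andP[cA Aa].
have [iA _] : int_le k \1_A a.
  have -> : \1_A = (fun y => 1 * \1_A y) :> (_ -> R) by apply/funext => y; rewrite mul1r.
  apply: int_le_indic => //; under eq_integral do rewrite mul1r.
  exact: Aa.
have E : (fun y => (- \1_A y * k y)%:E) = (fun y => - (\1_A y * k y)%:E)%E.
  by apply/funext => y; rewrite mulNr EFinN.
rewrite /int_le E; split; first exact: (integrableN iA).
rewrite integralN; last exact: integrable_add_def.
by rewrite EFinN leeN2 integral_indic.
Qed.

End weighted_integrals.

Section kernel_bounds.
Context {R : realType} {d : nat}.
Implicit Types (x y p : 'rV[R]_d) (k : 'rV[R]_d -> R) (A : set 'rV[R]_d).
Context (r0 lam Lam M a1 a2 delta1 delta2 f0 : R).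
Context (r0_gt0 : 0 < r0) (Lam_gt0 : 0 < Lam) (a1_gt0 : 0 < a1).

Let profile f := admissible_profile r0 a1 a2 delta1 delta2 f /\ f r0^-1 = f0.

Lemma int_le_moment f x k (n : nat) A c :
  kernel_at r0 lam Lam M f x k -> measurable A -> (moment x k n A <= c%:E)%E ->
  int_le k (fun y => enorm (y - x) ^+ n * \1_A y) c.
Proof.
move=> [mk k0 _ _] mA mc; apply: int_le_indic => //.
  by apply: measurable_funX; exact: measurable_enormB.
by move=> y; rewrite exprn_ge0// enorm_ge0.
Qed.

(** Jumps shorter than r0 are controlled by the zeroth moment; the longer ones
have mass at most M, which is absorbed because f (1 / s) >= f0 > 0. *)
Lemma far_mass : 0 < delta1 -> exists2 T, 0 < T & forall f x k,
  profile f -> kernel_at r0 lam Lam M f x k -> forall s, 0 < s -> s <= r0 ->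
  int_le k \1_(far x s) (T * f s^-1).
Proof.
move=> d1; have [t t4] := @exists_expanding_scale R (2 / a1) delta1 0 d1.
rewrite expr0 mulr1 ler_pdivrMr// => ht.
have t2 : 2 <= t by lra. have t0 : 0 < t by lra.
pose T1 := 2 * (Lam * t ^+ 0 * (2 * t) ^+ d).
have T10 : 0 < T1 by rewrite /T1 expr0 mulr1 !mulr_gt0// exprn_gt0// mulr_gt0.
exists (T1 + `|M / f0|); first by rewrite ltr_pwDl.
move=> f x k [fP ff0] kP s s0 sr; have [mk k0 _ kM] := kP.
have h1 : int_le k (fun y => enorm (y - x) ^+ 0 * \1_(shell x s r0) y) (T1 * f s^-1).
  apply: (int_le_moment kP); first exact: measurable_shell.
  rewrite (_ : T1 * _ = T1 * (s ^+ 0 * f s^-1)); last by rewrite expr0 mul1r.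
  apply: (moment_tail r0_gt0 Lam_gt0 a1_gt0 fP kP (p := 0%N) t2 _ s0 sr).
  by rewrite expr0 mulr1 (mulrC a1).
have h2 : int_le k (fun y => 1 * \1_(far x r0) y) M.
  apply: int_le_indic => //; first exact: measurable_far.
  by under eq_integral do rewrite mul1r.
have f00 : 0 < f0 by rewrite -ff0 (profileV_gt0 r0_gt0 a1_gt0 fP).
have f0s : f0 <= f s^-1 by rewrite -ff0 (profile_mono fP).
apply: (@int_le_weaken _ _ _ _ (T1 * f s^-1 + M)).
  rewrite mulrDl lerD2l (le_trans (ler_norm M))//.
  rewrite -{1}(divfK (lt0r_neq0 f00) M) normrM (gtr0_norm f00).
  by rewrite ler_wpM2l.
apply: (int_le_mono _ _ _ _ (int_leD h1 h2)) => //.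
  by apply: measurable_indic; exact: measurable_far.
move=> y; rewrite expr0 !mul1r !indicE; apply/andP; split; first by [].
have [sy|] := boolP (y \in far x s); last by rewrite addr_ge0.
have [ry|ry] := leP r0 (enorm (y - x)).
  by rewrite [y \in far x r0]mem_set// lerDr.
by rewrite [y \in shell x s r0]mem_set ?lerDl//; rewrite inE in sy; rewrite /shell/= ry andbT.
Qed.

Lemma near_moment (n : nat) : (0 < n)%N -> delta2 < n%:R -> exists2 C, 0 < C & forall f x k,
  profile f -> kernel_at r0 lam Lam M f x k -> forall s, 0 < s -> s <= r0 ->
  int_le k (fun y => enorm (y - x) ^+ n * \1_(eball x s) y) (C * (s ^+ n * f s^-1)).
Proof.
move=> n0 d2; have [t t4 ht] := @exists_contracting_scale R (2 * a2) delta2 n d2.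
have t2 : 2 <= t by lra. have t0 : 0 < t by lra.
exists (Lam * t ^+ n * (2 * t) ^+ d).
  by rewrite !mulr_gt0// exprn_gt0// mulr_gt0.
move=> f x k [fP ff0] kP s s0 sr.
apply: (int_le_moment kP); first exact: measurable_eball.
exact: (moment_inner r0_gt0 Lam_gt0 a1_gt0 fP kP n0 t2 ht s0 sr).
Qed.

Lemma shell_moment1 : 1 < delta1 -> exists2 C, 0 < C & forall f x k,
  profile f -> kernel_at r0 lam Lam M f x k -> forall s, 0 < s -> s <= r0 ->
  int_le k (fun y => enorm (y - x) ^+ 1 * \1_(shell x s r0) y) (C * (s ^+ 1 * f s^-1)).
Proof.
move=> d1; have [t t4] := @exists_expanding_scale R (2 / a1) delta1 1 d1.
rewrite mulrAC ler_pdivrMr// => ht.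
have t2 : 2 <= t by lra. have t0 : 0 < t by lra.
exists (2 * (Lam * t ^+ 1 * (2 * t) ^+ d)).
  by rewrite !mulr_gt0// ?exprn_gt0// mulr_gt0.
move=> f x k [fP ff0] kP s s0 sr.
apply: (int_le_moment kP); first exact: measurable_shell.
apply: (moment_tail r0_gt0 Lam_gt0 a1_gt0 fP kP (p := 1%N) (t := t) t2 _ s0 sr).
by rewrite mulrC [leRHS]mulrC mulrC.
Qed.

(** The difference between the first order term that a test function at scale s
needs and the one that the operator subtracts. *)
Definition drift p x s y : R := edot p (y - x) *
  ((enorm (y - x) < s)%R%:R - (enorm (y - x) < r0)%R%:R * (1 <= delta2)%R%:R).

Definition drift_bounded C f x k := forall p s, 0 < s -> s <= r0 ->
  int_le k (drift p x s) (C * (enorm p * s * f s^-1)).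

Lemma measurable_drift p x s : measurable_fun setT (drift p x s).
Proof.
apply: measurable_funM; first exact: measurable_edotB.
have mi a : measurable_fun setT (fun y => (enorm (y - x) < a)%R%:R : R).
  rewrite (_ : (fun _ => _) = \1_(eball x a)).
    by apply: measurable_indic; exact: measurable_eball.
  apply/funext => y; rewrite indicE; congr (nat_of_bool _)%:R.
  by apply/idP/idP; rewrite inE.
apply: measurable_funB; first exact: mi.
by apply: measurable_funM; [exact: mi|exact: measurable_cst].
Qed.

Lemma drift_bounded_low_order : delta2 < 1 -> exists2 C, 0 < C & forall f x k,
  profile f -> kernel_at r0 lam Lam M f x k -> drift_bounded C f x k.
Proof.
move=> d2; have [C C0 CP] := @near_moment 1 isT d2.
exists C => // f x k fP kP p s s0 sr.
have := int_leZ (enorm_ge0 p) (CP f x k fP kP s s0 sr).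
have [mk k0 _ _] := kP.
rewrite expr1 (_ : _ * (C * _) = C * (enorm p * s * f s^-1)); last by ring.
apply: int_le_abs => //; first exact: measurable_drift.
move=> y; rewrite /drift (leNgt 1 delta2) d2/= mulr0 subr0 expr1 normrM mulrA indicE.
rewrite ler_pM//; first exact: edot_le.
by rewrite ger0_norm// ler_nat; case: ltP => // ys; rewrite mem_set.
Qed.

Lemma drift_shell p x s y : s <= r0 -> 1 <= delta2 ->
  drift p x s y = - edot p (y - x) * \1_(shell x s r0) y.
Proof.
move=> sr d2; rewrite /drift d2 mulr1 indicE mulNr -mulrN; congr (_ * _).
have [ys|sy] := ltP (enorm (y - x)) s.
  rewrite (lt_le_trans ys sr) subrr memNset ?oppr0//.
  by move=> /andP[/(lt_le_trans ys)]; rewrite ltxx.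
rewrite sub0r; congr (- (nat_of_bool _)%:R).
by apply/idP/idP; rewrite inE /shell/= sy.
Qed.

Lemma drift_bounded_high_order : 1 < delta1 -> 1 <= delta2 -> exists2 C, 0 < C & forall f x k,
  profile f -> kernel_at r0 lam Lam M f x k -> drift_bounded C f x k.
Proof.
move=> d1 d2; have [C C0 CP] := shell_moment1 d1.
exists C => // f x k fP kP p s s0 sr.
have := int_leZ (enorm_ge0 p) (CP f x k fP kP s s0 sr).
have [mk k0 _ _] := kP.
rewrite expr1 (_ : _ * (C * _) = C * (enorm p * s * f s^-1)); last by ring.
apply: int_le_abs => //; first exact: measurable_drift.
move=> y; rewrite drift_shell// expr1 normrM mulrA normrN.
by rewrite ler_pM//; [exact: edot_le|rewrite ger0_norm].
Qed.

(** The drift is odd around x and k is even around x, so the integral equals its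
opposite by reflection at x. *)
Lemma drift_bounded_symmetric : 1 <= delta2 -> forall f x k,
  profile f -> kernel_at r0 lam Lam M f x k ->
  (forall z, z != 0 -> k (x + z) = k (x - z)) -> drift_bounded 1 f x k.
Proof.
move=> d2 f x k fP kP ksym p s s0 sr; have [mk k0 _ _] := kP.
have [c hc] : exists c, int_le k (fun y => enorm (y - x) ^+ 1 * \1_(shell x s r0) y) c.
  eexists; apply: (int_le_moment kP); first exact: measurable_shell.
  apply: (moment_shell r0_gt0 Lam_gt0 a1_gt0 fP.1 kP 1 (t := r0 / s) s0 sr (lexx _)).
  by rewrite divfK// gt_eqF.
have [ig _] : int_le k (drift p x s) (enorm p * c).
  apply: int_le_abs (int_leZ (enorm_ge0 p) hc) => //; first exact: measurable_drift.
  move=> y; rewrite drift_shell// expr1 normrM mulrA normrN.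
  by rewrite ler_pM//; [exact: edot_le|rewrite ger0_norm].
split => //.
pose g := fun y => (drift p x s y * k y)%:E.
have mg : measurable_fun setT g.
  by apply: measurable_EFin_mul => //; exact: measurable_drift.
have gr : g \o reflect (x + x) = (fun y => - g y)%E.
  apply/funext => y; rewrite /g/= /reflect -mulNr; congr (_ * _)%:E.
    rewrite /drift (_ : x + x - y - x = - (y - x)); last first.
      by apply/rowP => i; rewrite !mxE; ring.
    by rewrite edotNr enormN mulNr.
  have [->|yx] := eqVneq y x; first by rewrite addrK.
  rewrite (_ : x + x - y = x - (y - x)); last by apply/rowP => i; rewrite !mxE; ring.
  by rewrite -ksym ?subr_eq0// addrC subrK.
have gE : (\int[lebesgue_rV d]_y g y = \int[lebesgue_rV d]_y (g \o reflect (x + x)) y)%E.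
  rewrite -(integral_pushforward (measurable_reflect (x + x)) (mu := lebesgue_rV d)
    (D := setT) mg)//.
    apply: eq_measure_integral => [|m A mA _]; first exact: measurable_reflect.
    exact/esym/lebesgue_rV_reflect.
  by rewrite preimage_setT gr; exact: integrableN ig.
rewrite gr integralN in gE; last exact: integrable_add_def.
have /fin_numP[] := integrable_fin_num measurableT ig.
rewrite -/g in gE *; move: gE; case: (integral _ _ _) => // r + _ _.
move=> -[rr]; rewrite lee_fin (_ : r = 0); last by lra.
by rewrite mul1r !mulr_ge0 ?enorm_ge0 ?ltW// (profileV_gt0 r0_gt0 a1_gt0 fP.1).
Qed.

End kernel_bounds.

(** * Testing the viscosity inequalities with paraboloids *)

Section viscosity_testing.
Context {R : realType} {d : nat}.
Implicit Types (x y z p : 'rV[R]_d) (w u : 'rV[R]_d -> R) (D : set 'rV[R]_d).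
Implicit Types (k h : 'rV[R]_d -> R).
Context (r0 delta2 : R).

(** The integral of a nonnegative function is a supremum over the simple functions
below it, hence monotone; the general case follows by positive and negative
parts. In this form it applies directly to the patched test functions. *)
Lemma integral_mono (mu : {measure set 'rV[R]_d -> \bar R}) (f g : 'rV[R]_d -> \bar R) :
  (forall y, f y <= g y)%E -> (\int[mu]_y f y <= \int[mu]_y g y)%E.
Proof.
move=> fg.
have ge0_mono (f' g' : 'rV[R]_d -> \bar R) : (forall y, 0 <= f' y)%E ->
    (forall y, f' y <= g' y)%E -> (\int[mu]_y f' y <= \int[mu]_y g' y)%E.
  move=> f0 fg'; rewrite !ge0_integralTE//; last first.
    by move=> y; rewrite (le_trans (f0 y)).
  apply: le_ereal_sup => _ [s sf <-]; exists s => // y.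
  by rewrite (le_trans (sf y)).
rewrite integralE [leRHS]integralE; apply: leeB; apply: ge0_mono => // y.
  by rewrite !funeposE ge_max !le_max fg lexx/= orbT.
by rewrite !funenegE ge_max !le_max leeN2 fg lexx/= orbT.
Qed.

Definition touch w x s p b y := if enorm (y - x) < s then quad x (w x) p b y else w y.

Definition test_integrand w x s p b y : R :=
  touch w x s p b y - w x
    - edot p (y - x) * (enorm (y - x) < r0)%R%:R * (1 <= delta2)%R%:R.

(** The form in which the viscosity inequality for the extremal operator is used:
for every c > 0 some kernel of the family F gives integral at least - c to each
integrable function that dominates the integrand of the operator on a paraboloid
touching w from above. The subsolution property of u and the supersolution
property of u, read on - u, both take this form, which no longer refers to
suprema, infima or extended reals. *)
Definition tested (F : 'rV[R]_d -> set ('rV[R]_d -> R)) D w := forall x s p b,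
  D x -> 0 < s -> eball x s `<=` D ->
  (forall y, 0 < enorm (y - x) < s -> w y < quad x (w x) p b y) ->
  forall c, 0 < c -> exists2 k, F x k & forall h c', int_le k h c' ->
    (forall y, test_integrand w x s p b y <= h y) -> - c <= c'.

Definition off_diagonal (K : 'rV[R]_d -> 'rV[R]_d -> R) x y : R :=
  if y == x then 0 else K x y.

Definition kernels_at (A : set ('rV[R]_d -> 'rV[R]_d -> R)) x : set ('rV[R]_d -> R) :=
  [set off_diagonal K x | K in A].

Lemma patch_touch w x s p b :
  patch w (eball x s) (quad x (w x) p b) = touch w x s p b.
Proof.
apply/funext => y; rewrite /patch /touch; congr (if _ then _ else _).
by apply/idP/idP; rewrite inE.
Qed.

Lemma grad_touch w x s p b : 0 < s -> grad (touch w x s p b) x = p.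
Proof.
move=> s0; rewrite -[RHS](grad_quad x (w x) p b); apply/rowP => i; rewrite !mxE.
apply: near_eq_derive.
have : nbhs x (eball x s).
  by apply: open_nbhs_nbhs; split; [exact: eball_open|rewrite /eball/= enormxx].
by apply: filterS => y /= ys; rewrite /touch ys.
Qed.

Lemma LK_touch K w x s p b : 0 < s ->
  LK r0 delta2 K (patch w (eball x s) (quad x (w x) p b)) x =
  (\int[lebesgue_rV d]_y (test_integrand w x s p b y * off_diagonal K x y)%:E)%E.
Proof.
move=> s0; rewrite /LK patch_touch grad_touch//; apply: eq_integral => y _.
rewrite /test_integrand /off_diagonal {2}/touch enormxx s0 quadxx.
case: eqVneq => [->|//]; rewrite mulr0 {1}/touch enormxx s0 quadxx !subrr edot0r.
by rewrite !mul0r subr0 mul0r.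
Qed.

Lemma kernels_at_ge0 (A : set ('rV[R]_d -> 'rV[R]_d -> R)) x k :
  (forall K, A K -> forall x y, x != y -> 0 <= K x y) ->
  kernels_at A x k -> forall y, 0 <= k y.
Proof.
move=> A0 [K AK <-] y; rewrite /off_diagonal; case: eqVneq => // yx.
by rewrite (A0 K AK)// eq_sym.
Qed.

(** A nonnegative supremum exceeds - c at some kernel. If the class is empty the
supremum is -oo and no paraboloid can touch from above. *)
Lemma visc_ge0_tested (A : set ('rV[R]_d -> 'rV[R]_d -> R)) D u :
  (forall K, A K -> forall x y, x != y -> 0 <= K x y) ->
  visc_ge0 (Mplus [set LK r0 delta2 K | K in A]) D u ->
  tested (kernels_at A) D u.
Proof.
move=> A0 [_ uv] x s p b Dx s0 xsD above c c0.
have := uv x (eball x s) (quad x (u x) p b) Dx (@eball_open R d x s) _ xsD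
  (@C2_quad _ _ _ _ _ _ _) (quadxx _ _ _ _).
rewrite {1}/eball/= enormxx => /(_ s0) sup0.
have {sup0} : ((- c)%:E < Mplus [set LK r0 delta2 K | K in A]
    (patch u (eball x s) (quad x (u x) p b)) x)%E.
  apply: lt_le_trans (sup0 _); first by rewrite lte_fin oppr_lt0.
  by move=> y ys yx; apply: above; rewrite enorm_gt0 yx.
move=> /ereal_sup_gt [_ [_ [K AK <-] <-]]; rewrite LK_touch// => cK.
exists (off_diagonal K x); first by exists K.
move=> h c' [ih hc'] th; rewrite -lee_fin; apply: (le_trans (ltW cK)).
apply: le_trans hc'; apply: integral_mono => y; rewrite lee_fin ler_wpM2r//.
by apply: (kernels_at_ge0 A0); exists K.
Qed.

(** Same argument for the infimum. The integral of - g is compared with the operator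
only for the integrable dominating function, since negation does not commute
with integrals of the form oo - oo. *)
Lemma visc_le0_tested (A : set ('rV[R]_d -> 'rV[R]_d -> R)) D u :
  (forall K, A K -> forall x y, x != y -> 0 <= K x y) ->
  visc_le0 (Mminus [set LK r0 delta2 K | K in A]) D u ->
  tested (kernels_at A) D (fun y => - u y).
Proof.
move=> A0 [_ uv] x s p b Dx s0 xsD below c c0.
have qN y : quad x (- u x) p b y = - quad x (u x) (- p) (- b) y.
  by rewrite /quad edotNl !mulNr; ring.
have := uv x (eball x s) (quad x (u x) (- p) (- b)) Dx (@eball_open R d x s) _ xsD
  (@C2_quad _ _ _ _ _ _ _) (quadxx _ _ _ _).
rewrite {1}/eball/= enormxx => /(_ s0) inf0.
have {inf0} : (Mminus [set LK r0 delta2 K | K in A]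
    (patch u (eball x s) (quad x (u x) (- p) (- b))) x < c%:E)%E.
  apply: le_lt_trans (inf0 _) _; last by rewrite lte_fin.
  move=> y ys yx; have := below y; rewrite enorm_gt0 yx qN => /(_ ys).
  by rewrite ltrN2.
move=> /ereal_inf_lt [_ [_ [K AK <-] <-]]; rewrite LK_touch// => cK.
exists (off_diagonal K x); first by exists K.
move=> h c' [ih hc'] th; rewrite lerNl -lee_fin; apply: le_trans (ltW cK).
have : (- c'%:E <= \int[lebesgue_rV d]_y - (h y * off_diagonal K x y)%:E)%E.
  by rewrite integralN ?leeN2//; exact: integrable_add_def.
rewrite -EFinN => /le_trans; apply; apply: integral_mono => y.
rewrite -EFinN lee_fin -mulNr ler_wpM2r//.
  by apply: (kernels_at_ge0 A0); exists K.
rewrite lerNl (le_trans _ (th y))// /test_integrand /touch qN edotNl.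
by case: ifP => _; lra.
Qed.

Lemma kernel_at_of_bounds (lam Lam M0 : R) (f : R -> R) J K x :
  0 < r0 -> 0 < lam -> 0 < Lam -> admissible_kernel r0 M0 f J -> measurable_offdiag K ->
  (forall x y, x != y -> lam * J x y <= K x y <= Lam * J x y) ->
  kernel_at r0 lam Lam (Lam * M0) f x (off_diagonal K x).
Proof.
move=> r0_gt0 lam0 Lam0 [J0 mJ JM Jf] mK KJ.
have mj := measurable_section x mJ; have mk := measurable_section x mK.
have jge0 y : 0 <= off_diagonal J x y.
  by rewrite /off_diagonal; case: eqVneq => // yx; rewrite J0// eq_sym.
have kge0 y : 0 <= off_diagonal K x y.
  rewrite /off_diagonal; case: eqVneq => // yx.
  have /andP[+ _] := KJ x y ltac:(by rewrite eq_sym).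
  by apply: le_trans; rewrite mulr_ge0 ?(ltW lam0)// J0// eq_sym.
split => //.
- move=> y /andP[y0 yr]; rewrite /off_diagonal ifF; last first.
    by apply/negbTE; rewrite -enorm_gt0.
  have xy : x != y by rewrite eq_sym -enorm_gt0.
  by have := KJ x y xy; rewrite Jf enormC ?y0.
- have : (\int[lebesgue_rV d]_(y in far x r0) (off_diagonal J x y)%:E <= M0%:E)%E.
    rewrite -JM; apply: ereal_sup_ubound; exists x => //.
    apply: eq_integral => y; rewrite inE /far/= => ry.
    rewrite /off_diagonal ifF//; apply/negbTE; rewrite -enorm_gt0.
    exact: lt_le_trans ry.
  move=> jM; rewrite EFinM; apply: le_trans (lee_wpmul2l _ jM); last by rewrite lee_fin ltW.
  rewrite -ge0_integralZl//; last 4 first.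
  + exact: measurable_far.
  + by apply/measurable_EFinP; apply: measurable_funTS.
  + by move=> y _; rewrite lee_fin.
  + by rewrite lee_fin ltW.
  apply: ge0_le_integral => //.
  + exact: measurable_far.
  + by move=> y _; rewrite lee_fin.
  + by apply/measurable_EFinP; apply: measurable_funTS.
  + apply/measurable_EFinP; apply: measurable_funM; first exact: measurable_cst.
    exact: measurable_funTS.
  + move=> y _; rewrite lee_fin /off_diagonal; case: eqVneq => [_|yx]; first by rewrite mulr0.
    by have /andP[] := KJ x y ltac:(by rewrite eq_sym).
Qed.

End viscosity_testing.

(** * Diminish of oscillation from one side *)

Section diminish.
Context {R : realType} {d : nat}.
Implicit Types (x y z p : 'rV[R]_d) (w u : 'rV[R]_d -> R) (D : set 'rV[R]_d).
Implicit Types (k : 'rV[R]_d -> R).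
Context (r0 lam Lam M a1 a2 delta1 delta2 f0 : R).
Context (d_gt0 : (0 < d)%N) (r0_gt0 : 0 < r0) (lam_gt0 : 0 < lam)
  (a1_gt0 : 0 < a1) (a2_gt0 : 0 < a2).
Context (T C2 C3 : R) (T_gt0 : 0 < T) (C2_gt0 : 0 < C2) (C3_gt0 : 0 < C3).

(** The scale invariant bounds on the section of a kernel at x, with constants that do
not depend on the kernel. *)
Definition good_kernel f x k := [/\ admissible_profile r0 a1 a2 delta1 delta2 f /\ f r0^-1 = f0,
  kernel_at r0 lam Lam M f x k,
  drift_bounded r0 delta2 C3 f x k,
  forall s, 0 < s -> s <= r0 -> int_le k \1_(far x s) (T * f s^-1) &
  forall s, 0 < s -> s <= r0 ->
    int_le k (fun y => enorm (y - x) ^+ 2 * \1_(eball x s) y) (C2 * (s ^+ 2 * f s^-1))].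

Local Notation good := good_kernel.

(** Jumps of length at most rho into a quarter of the cube of side rho / (2 d) have
mass at least kappa f (1 / rho), by [cube_mass]. *)
Definition kappa : R := lam * (2 * d%:R)^-1 ^+ d / 4.

Lemma kappa_gt0 : 0 < kappa.
Proof. by rewrite /kappa divr_gt0// mulr_gt0// exprn_gt0// invr_gt0 mulr_gt0// ltr0n. Qed.

(** A ball of radius b / 4 has measure at most (b / 2)^d, at most a quarter of
the measure of the cube since d >= 1; removing it leaves room for the test paraboloid. *)
Lemma quarter_cube (G : set 'rV[R]_d) x z b : 0 < b -> measurable G ->
  ((2^-1 * (2 * b) ^+ d)%:E <= lebesgue_rV d (G `&` cube z b))%E ->
  ((4^-1 * (2 * b) ^+ d)%:E <= lebesgue_rV d ((G `&` cube z b) `\` eball x (b / 4)))%E.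
Proof.
move=> b0 mG hG; have b40 : 0 < b / 4 by rewrite divr_gt0.
have mGc : measurable (G `&` cube z b) by apply: measurableI => //; exact: measurable_cube.
have h1 : (lebesgue_rV d (G `&` cube z b) <=
    lebesgue_rV d ((G `&` cube z b) `\` eball x (b / 4)) + lebesgue_rV d (eball x (b / 4)))%E.
  apply: (@le_trans _ _ (lebesgue_rV d (((G `&` cube z b) `\` eball x (b / 4)) `|`
    eball x (b / 4)))).
    apply: le_measure; rewrite ?inE//.
      apply: measurableU; last exact: measurable_eball.
      by apply: measurableD => //; exact: measurable_eball.
    by move=> y Gy; have [yx|yx] := pselect (eball x (b / 4) y); [right|left].
  apply: measureU2; last exact: measurable_eball.
  by apply: measurableD => //; exact: measurable_eball.
have h2 := lebesgue_eball_le x b40.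
have h3 : (2 * (b / 4)) ^+ d <= 4^-1 * (2 * b) ^+ d.
  rewrite (_ : 2 * (b / 4) = 4^-1 * (2 * b)); last by ring.
  rewrite exprMn ler_pM2r ?exprn_gt0 ?mulr_gt0//.
  by rewrite -[leRHS]expr1 ler_wiXn2l//; lra.
have := le_trans hG (le_trans h1 (leeD (lexx _) (le_trans h2 _))).
move=> /(_ (4^-1 * (2 * b) ^+ d)%:E); rewrite lee_fin => /(_ h3).
rewrite -leeBlDr// -EFinB => /(le_trans _); apply; rewrite lee_fin.
lra.
Qed.

Lemma cube_mass f x k z (rho : R) (G : set 'rV[R]_d) :
  good f x k -> 0 < rho -> 2 * rho <= r0 ->
  eball z (rho / 2) x -> measurable G ->
  ((2^-1 * (2 * (rho / (4 * d%:R))) ^+ d)%:E <=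
     lebesgue_rV d (G `&` cube z (rho / (4 * d%:R))))%E ->
  int_le k (fun y => - \1_((G `&` cube z (rho / (4 * d%:R))) `\` eball x (rho / (4 * d%:R) / 4)) y)
    (- (kappa * f rho^-1)).
Proof.
move=> [[fP ff0] kP _ kT _] rho0 rhor xz mG hG; have [mk k0 kb kM] := kP.
have dR0 : 0 < d%:R :> R by rewrite ltr0n.
have dR1 : 1 <= d%:R :> R by rewrite ler1n.
set b := rho / (4 * d%:R) in hG *; have b0 : 0 < b by rewrite divr_gt0// mulr_gt0.
set G' := (G `&` cube z b) `\` _.
have br : b / 4 <= r0.
  have : b <= rho / 4 by rewrite /b ler_pM2l// lef_pV2 ?posrE ?mulr_gt0//; lra.
  lra.
have b40 : 0 < b / 4 by rewrite divr_gt0.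
have mG' : measurable G'.
  apply: measurableD; last exact: measurable_eball.
  by apply: measurableI => //; exact: measurable_cube.
have f_pos : 0 < f rho^-1 by apply: (profileV_gt0 r0_gt0 a1_gt0 fP) => //; lra.
apply: (@int_leN_indic _ _ _ _ _ (T * f (b / 4)^-1)) => //.
apply/andP; split; last first.
  have [_] := kT _ b40 br; apply: le_trans.
  rewrite integral_indic; last exact: measurable_far.
  apply: ge0_subset_integral => //.
  - exact: measurable_far.
  - by apply/measurable_EFinP; apply: measurable_funTS.
  - by move=> y _; rewrite lee_fin.
  - by move=> y [_ /negP]; rewrite /eball/= -leNgt.
pose c := lam * (f rho^-1 / rho ^+ d).
have c0 : 0 <= c by rewrite ltW// mulr_gt0// divr_gt0// exprn_gt0.
apply: (@le_trans _ _ (\int[lebesgue_rV d]_(y in G') c%:E)%E); last first.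
  apply: ge0_le_integral => //.
  - by apply/measurable_EFinP; apply: measurable_funTS.
  move=> y [[_ yc] /negP]; rewrite /eball/= -leNgt => xy; rewrite lee_fin.
  have y0 : 0 < enorm (y - x) by exact: lt_le_trans xy.
  have yrho : enorm (y - x) < rho.
    have := cube_sub_eball d_gt0 yc; rewrite /eball/=.
    rewrite (_ : d%:R * b = rho / 4); last by rewrite /b; field; rewrite gt_eqF.
    have := enormB y z x; move: xz; rewrite /eball/= (enormC x z); lra.
  have /andP[+ _] := kb y ltac:(by rewrite y0 (lt_le_trans yrho)//; lra).
  apply: le_trans; rewrite /c ler_pM2l// ler_pM//.
  - exact: ltW.
  - by rewrite invr_ge0 exprn_ge0// ltW.
  - by apply: (profile_mono fP) => //; exact: ltW.
  - by rewrite lef_pV2 ?posrE ?exprn_gt0// lerXn2r ?nnegrE ?enorm_ge0 ?(ltW rho0)// ltW.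
rewrite integral_cst//; apply: le_trans (lee_wpmul2l _ (quarter_cube x b0 mG hG));
  last by rewrite lee_fin.
rewrite -EFinM lee_fin le_eqVlt; apply/orP; left; apply/eqP.
rewrite /c /kappa /b (_ : 2 * (rho / (4 * d%:R)) = rho * (2 * d%:R)^-1); last first.
  by field; rewrite gt_eqF.
by rewrite exprMn; field; rewrite expf_neq0// gt_eqF.
Qed.

(** The factor lost in replacing f (2 / rho) by f (1 / rho). *)
Definition growth : R := a2 * 2 `^ delta2.
(** The opening of the paraboloid, relative to h: so small that its own cost, the
drift and the far mass stay below a fraction of the gain kappa. *)
Definition bump_size : R :=
  Num.min 1 (kappa / (16 * (growth * (C2 + T + C3)))).
Definition excess_tolerance : R := kappa / 16.

Lemma growth_gt0 : 0 < growth.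
Proof. by rewrite mulr_gt0// powR_gt0. Qed.

Lemma bump_size_gt0 : 0 < bump_size.
Proof.
rewrite lt_min ltr01 divr_gt0 ?kappa_gt0// !mulr_gt0// ?growth_gt0//.
by rewrite !addr_gt0.
Qed.

Lemma bump_size_le1 : bump_size <= 1. Proof. by rewrite ge_min lexx. Qed.

Lemma bump_size_small : bump_size * growth * (C2 + T + C3) <= kappa / 16.
Proof.
pose X := growth * (C2 + T + C3).
have X0 : 0 < X by rewrite mulr_gt0 ?growth_gt0 ?addr_gt0.
have : bump_size <= kappa / (16 * X) by rewrite ge_min lexx orbT.
have X16 : 0 < 16 * X by rewrite mulr_gt0.
rewrite ler_pdivlMr// => h; rewrite -mulrA -/X.
have -> : bump_size * X = bump_size * (16 * X) / 16 by field.
by rewrite ler_pM2r// invr_gt0.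
Qed.

(** The low part of the cube, deprived of the small ball on which the paraboloid
replaces w, lies within distance rho of the maximum point x. It keeps the mass
kappa f (1 / rho) and enters the operator with the value w y - w x. *)
Lemma diminish_above f (F : 'rV[R]_d -> set ('rV[R]_d -> R)) D w z (rho h m : R) :
  (forall x k, F x k -> good f x k) ->
  tested r0 delta2 F D w -> usc_within D w -> measurable_fun setT w ->
  0 < rho -> 2 * rho <= r0 -> eball z rho `<=` D -> 0 < h ->
  (forall y, eball z rho y -> w y <= m) ->
  (forall x k, eball z (rho / 2) x -> F x k ->
     int_le k (fun y => Num.max (w y - m) 0) (excess_tolerance * h * f rho^-1)) ->
  ((2^-1 * (2 * (rho / (4 * d%:R))) ^+ d)%:E <=
     lebesgue_rV d ([set y | w y <= m - h]%R `&` cube z (rho / (4 * d%:R))%R))%E ->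
  forall y, eball z (rho / 4) y -> w y <= m - bump_size / 8 * h.
Proof.
move=> Fgood tw uw mw rho0 rhor zD h0 wm wex hG x0 x0z.
rewrite leNgt; apply/negP => wx0.
set a := bump_size in wx0 *; have a0 : 0 < a := bump_size_gt0; have a1' : a <= 1 := bump_size_le1.
have dR1 : 1 <= d%:R :> R by rewrite ler1n.
have dR0 : 0 < d%:R :> R by rewrite ltr0n.
pose A := a * h / rho ^+ 2.
have A0 : 0 < A by rewrite /A divr_gt0 ?exprn_gt0// mulr_gt0.
have Arho : A * rho ^+ 2 = a * h by rewrite /A divfK// gt_eqF// exprn_gt0.
have Adiv (t : R) : A * (rho / t) ^+ 2 = a * h / t ^+ 2.
  by rewrite expr_div_n mulrA Arho.
have ah : a * h <= h by rewrite ler_piMl// ltW.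
have ah0 : 0 < a * h by rewrite mulr_gt0.
have cbD : ecball z (rho / 2) `<=` eball z rho.
  by move=> y; rewrite /ecball /eball/= => yz; rewrite (le_lt_trans yz)//; lra.
pose g y := A * enorm (y - z) ^+ 2.
have cg : continuous g.
  have sc : continuous (fun y => edot (y - z) (y - z)).
    by apply: edot_continuous => i; exact: coordB_continuous.
  rewrite (_ : g = (fun y => A * edot (y - z) (y - z))); last first.
    by apply/funext => y; rewrite /g enorm_sqr.
  by move=> y; exact: (cvgM (cvg_cst A) (sc y)).
have [||x xc xmax] := usc_attains_max (B := m) (@ecball_compact _ _ z (rho / 2))
   (usc_within_sub_continuous (usc_within_sub (subset_trans cbD zD) uw) cg).
- move=> y yc; have := wm y (cbD _ yc); have : 0 <= g y by rewrite mulr_ge0 ?sqr_ge0 ?ltW.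
  by lra.
- by exists x0; move: x0z; rewrite /ecball /eball/=; lra.
have x0c : ecball z (rho / 2) x0 by move: x0z; rewrite /ecball /eball/=; lra.
have gx0 : g x0 <= a * h / 16.
  have : enorm (x0 - z) ^+ 2 <= (rho / 4) ^+ 2.
    by apply: lerXn2r; rewrite ?nnegrE ?enorm_ge0//; move: x0z; rewrite /eball/=; lra.
  rewrite -(ler_pM2l A0) Adiv /g; lra.
have wxg : m - 3 * (a * h) / 16 < w x - g x by have := xmax x0 x0c; lra.
have far_g y : rho / 2 <= enorm (y - z) -> a * h / 4 <= g y.
  move=> yz; have : (rho / 2) ^+ 2 <= enorm (y - z) ^+ 2.
    by apply: lerXn2r; rewrite ?nnegrE ?enorm_ge0//; lra.
  rewrite -(ler_pM2l A0) Adiv /g; lra.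
have xz : eball z (rho / 2) x.
  rewrite /eball/= ltNge; apply/negP => /far_g gx.
  by have := wm x (cbD _ xc); lra.
(* Outside the closed ball of radius rho / 2 the paraboloid alone brings w - g
   below its value at x0, so x is a maximum over the whole ball. *)
have xmax' y : eball z rho y -> w y - g y <= w x - g x.
  move=> yz; have [yz2|zy] := leP (enorm (y - z)) (rho / 2); first exact: xmax.
  by have := far_g y (ltW zy); have := wm y yz; lra.
have wx : m - a * h / 4 <= w x.
  have : 0 <= g x by rewrite mulr_ge0 ?sqr_ge0 ?ltW.
  lra.
(* The gradient at x of A |y - z|^2. *)
pose p := (2 * A) *: (x - z).
have gE y : g y - g x = edot p (y - x) + A * edot (y - x) (y - x).
  rewrite /g !enorm_sqr /p edotZl.
  rewrite (_ : y - z = (y - x) + (x - z)); last by rewrite addrA subrK.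
  by rewrite edot_sqrD (edotC (y - x)); ring.
have pn : enorm p <= a * h / rho.
  have pE : enorm p = 2 * A * enorm (x - z).
    rewrite /p /enorm edotZl edotZr mulrA -expr2 sqrtrM ?sqr_ge0//.
    by rewrite sqrtr_sqr gtr0_norm// mulr_gt0.
  have Ar : A * rho = a * h / rho.
    by rewrite -Arho expr2 mulrA mulfK// gt_eqF.
  have : 2 * A * enorm (x - z) <= 2 * A * (rho / 2).
    have A20 : 0 < 2 * A by rewrite mulr_gt0.
    by rewrite ler_pM2l//; apply: ltW; exact: xz.
  rewrite pE -Ar; lra.
pose b := rho / (4 * d%:R).
have b0 : 0 < b by rewrite divr_gt0// mulr_gt0.
have brho : b <= rho / 4 by rewrite /b ler_pM2l// lef_pV2 ?posrE ?mulr_gt0//; lra.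
pose s := b / 4; have s0 : 0 < s by rewrite divr_gt0.
pose sg := rho / 2.
have ssg : s <= sg by rewrite /s /sg; lra.
have near_x y : enorm (y - x) < sg -> eball z rho y.
  move=> yx; have := enormB y x z; move: xz yx; rewrite /sg /eball/=; lra.
(* Doubling the second order coefficient makes the contact at x strict. *)
have touches y : 0 < enorm (y - x) < s -> w y < quad x (w x) p (2 * A) y.
  move=> /andP[y0 ys]; have := xmax' y (near_x y (lt_le_trans ys ssg)).
  have := gE y; rewrite /quad -enorm_sqr => gyx wy.
  have : 0 < A * enorm (y - x) ^+ 2 by rewrite mulr_gt0// exprn_gt0.
  lra.
have xD : D x by apply: zD; exact: cbD.
have sD : eball x s `<=` D.
  by move=> y ys; apply: zD; apply: near_x; exact: lt_le_trans ssg.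
(* Half of the surplus that remains once all costs are charged. *)
pose c := h * f rho^-1 * kappa / 16.
have f_pos : forall k, F x k -> 0 < f rho^-1.
  move=> k /Fgood[[fP _] _ _ _ _]; apply: (profileV_gt0 r0_gt0 a1_gt0 fP) => //; lra.
have [c0|c0] := ltP 0 c; last first.
  have [k Fk _] := tw x s p (2 * A) xD s0 sD touches 1 ltr01.
  have : 0 < c.
    rewrite /c divr_gt0//; apply: mulr_gt0; last exact: kappa_gt0.
    by apply: mulr_gt0 => //; exact: (f_pos k Fk).
  by rewrite ltNge c0.
have [k Fk test] := tw x s p (2 * A) xD s0 sD touches c c0.
have fpos := f_pos k Fk.
have kgood := Fgood x k Fk; have [[fP _] kP kD kT kC2] := kgood.
pose G := [set y | w y <= m - h].
have mG : measurable G.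
  rewrite (_ : G = setT `&` w @^-1` `]-oo, m - h]).
    by apply: mw => //; exact: measurable_itv.
  by rewrite setTI; apply/seteqP; split=> y /=; rewrite in_itv.
pose G' := (G `&` cube z b) `\` eball x s.
have sg0 : 0 < sg by rewrite divr_gt0.
have sgr : sg <= r0 by rewrite /sg; lra.
have i1 := int_leZ (a := 2 * A) ltac:(by rewrite mulr_ge0// ltW) (kC2 sg sg0 sgr).
have i2 := int_leZ (a := a * h / 4) ltac:(by rewrite divr_ge0// ltW) (kT sg sg0 sgr).
have i3 := wex x k xz Fk.
have i4 := int_leZ (a := h / 4) ltac:(by rewrite divr_ge0// ltW)
  (cube_mass kgood rho0 rhor xz mG hG).
have i5 := kD p sg sg0 sgr.
have Bf : f sg^-1 <= growth * f rho^-1.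
  by rewrite /sg /growth (profileV_le r0_gt0 a1_gt0 fP)//; lra.
have fsg0 : 0 < f sg^-1 by apply: (profileV_gt0 r0_gt0 a1_gt0 fP).
(* Two claims remain: the sum of the five terms dominates the integrand, and
   the sum of their bounds is below - c. *)
have contra (P Q : Prop) : (P -> Q) -> P -> (Q -> False) -> False.
  by move=> PQ HP NQ; exact: NQ (PQ HP).
apply: (contra _ _ (test _ _ (int_leD (int_leD (int_leD (int_leD i1 i2) i3) i4) i5))).
  move=> y; rewrite /test_integrand /drift.
  set E := edot p (y - x).
  have EB : enorm (y - x) < sg -> `|E| <= a * h / 2.
    move=> ysg; apply: (le_trans (edot_le p (y - x))).
    apply: (@le_trans _ _ (a * h / rho * sg)).
      by apply: ler_pM; rewrite ?enorm_ge0 ?(ltW ysg).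
    by rewrite /sg mulrA divfK// gt_eqF.
  have m0 : 0 <= Num.max (w y - m) 0 by rewrite le_max lexx orbT.
  have m1 : w y - m <= Num.max (w y - m) 0 by rewrite le_max lexx.
  have q0 : 0 <= A * enorm (y - x) ^+ 2 by rewrite mulr_ge0 ?sqr_ge0 ?ltW.
  have G'P : G' y -> [/\ w y <= m - h & (enorm (y - x) < s) = false].
    by move=> [[wy _] ys]; split => //; apply/negP.
  rewrite !indicE.
  have [ysg|sgy] := ltP (enorm (y - x)) sg.
    have yz := near_x y ysg; have := EB ysg; rewrite ler_norml => /andP[E1 E2].
    rewrite (_ : y \in eball x sg)%R; last by rewrite inE.
    rewrite (_ : (y \in far x sg) = false); last first.
      by apply/negP; rewrite inE /far/= leNgt ysg.
    have := xmax' y yz; have := gE y; rewrite -/E -enorm_sqr => gy wy.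
    have [yG|yG] := boolP (y \in G').
      have [wym ys] := G'P (set_mem yG).
      rewrite /touch ys /=; lra.
    rewrite /touch /quad -/E -enorm_sqr /=; case: ifP => _; lra.
  have ys : (enorm (y - x) < s) = false by apply/negbTE; rewrite -leNgt (le_trans ssg).
  rewrite (_ : (y \in eball x sg) = false); last first.
    by apply/negP; rewrite inE /eball/= ltNge sgy.
  rewrite (_ : y \in far x sg)%R; last by rewrite inE.
  rewrite /touch ys.
  have [yG|yG] := boolP (y \in G') => /=; last lra.
  have [wym _] := G'P (set_mem yG); lra.
have hf0 : 0 < h * f rho^-1 by rewrite mulr_gt0.
have hk0 : 0 < h * f rho^-1 * kappa by rewrite mulr_gt0// kappa_gt0.
have j0 : a * h * f sg^-1 <= a * growth * (h * f rho^-1).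
  rewrite (_ : a * growth * (h * f rho^-1) = a * h * (growth * f rho^-1)); last by ring.
  by rewrite ler_pM2l.
have pj : enorm p * sg * f sg^-1 <= a * h / 2 * f sg^-1.
  rewrite ler_pM2r//; apply: (@le_trans _ _ (a * h / rho * sg)); first by rewrite ler_pM2r.
  by rewrite /sg mulrA divfK// gt_eqF.
have pj' := ler_wpM2l (ltW C3_gt0) pj.
have small := bump_size_small; rewrite -/a -(ler_pM2r hf0) in small.
have S0 : 0 < C2 + T + C3 by rewrite !addr_gt0.
have j1 : a * h * f sg^-1 * (C2 + T + C3) <= h * f rho^-1 * kappa / 16.
  rewrite (_ : h * f rho^-1 * kappa / 16 = kappa / 16 * (h * f rho^-1)); last by ring.
  apply: (le_trans (ler_wpM2r (ltW S0) j0)); apply: le_trans small.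
  by rewrite le_eqVlt; apply/orP; left; apply/eqP; ring.
have j2 : 2 * A * (C2 * (sg ^+ 2 * f sg^-1)) = a * h * f sg^-1 * C2 / 2.
  have := Adiv 2; rewrite -/sg => As.
  rewrite (_ : 2 * A * _ = 2 * (A * sg ^+ 2) * C2 * f sg^-1); last by ring.
  by rewrite As; field.
rewrite j2 /c /excess_tolerance.
set X := a * h * f sg^-1 in j1 *; set Y := h * f rho^-1 * kappa in hk0 j1 *.
have X0 : 0 < X by rewrite /X mulr_gt0.
have XC2 : 0 < X * C2 by rewrite mulr_gt0. have XT : 0 < X * T by rewrite mulr_gt0.
have XC3 : 0 < X * C3 by rewrite mulr_gt0.
rewrite (_ : a * h / 4 * (T * f sg^-1) = X * T / 4); last by rewrite /X; field.
rewrite (_ : kappa / 16 * h * f rho^-1 = Y / 16); last by rewrite /Y; field.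
rewrite (_ : h / 4 * - (kappa * f rho^-1) = - Y / 4); last by rewrite /Y; field.
rewrite (_ : C3 * (a * h / 2 * f sg^-1) = X * C3 / 2) in pj'; last by rewrite /X; field.
rewrite !mulrDr in j1.
lra.
Qed.

End diminish.

(** * Decay of the oscillation *)

Section oscillation.
Context {R : realType} {d : nat}.
Implicit Types (x y z p : 'rV[R]_d) (w u : 'rV[R]_d -> R) (D : set 'rV[R]_d).
Context (r0 lam Lam M a1 a2 delta1 delta2 f0 : R).
Context (d_gt0 : (0 < d)%N) (r0_gt0 : 0 < r0) (lam_gt0 : 0 < lam)
  (a1_gt0 : 0 < a1) (a2_gt0 : 0 < a2).
Context (T C2 C3 : R) (T_gt0 : 0 < T) (C2_gt0 : 0 < C2) (C3_gt0 : 0 < C3).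
Context (theta q : R) (theta_ge4 : 4 <= theta) (theta_f : 2 <= a1 * theta `^ delta1).

Local Notation good f x k := (@good_kernel R d r0 lam Lam M a1 a2 delta1 delta2 f0 T C2 C3 f x k).
Local Notation gam := (@bump_size R d lam a2 delta2 T C2 C3).
Local Notation eps := (@excess_tolerance R d lam).
Local Notation B := (@growth R a2 delta2).
Context (q_le1 : q <= 1) (q_ge : 3 / 4 <= q) (q_gam : 2 * (1 - q) <= gam / 8)
  (q_eps : 2 * (1 - q) * T * B <= eps / 4).

(** The two sets cover the cube, so they cannot both have less than half of its measure. *)
Lemma cube_halves (u : 'rV[R]_d -> R) z (m b : R) : measurable_fun setT u -> 0 < b ->
  ((2^-1 * (2 * b) ^+ d)%:E <= lebesgue_rV d ([set y | u y <= m]%R `&` cube z b))%E \/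
  ((2^-1 * (2 * b) ^+ d)%:E <= lebesgue_rV d ([set y | - u y <= - m]%R `&` cube z b))%E.
Proof.
move=> mu b0.
have mA : measurable ([set y | u y <= m] `&` cube z b).
  apply: measurableI; last exact: measurable_cube.
  rewrite (_ : mkset _ = setT `&` u @^-1` `]-oo, m]).
    by apply: mu => //; exact: measurable_itv.
  by rewrite setTI; apply/seteqP; split=> y /=; rewrite in_itv.
have mB : measurable ([set y | - u y <= - m] `&` cube z b).
  apply: measurableI; last exact: measurable_cube.
  rewrite (_ : mkset _ = setT `&` u @^-1` `[m, +oo[).
    by apply: mu => //; exact: measurable_itv.
  by rewrite setTI; apply/seteqP; split=> y /=; rewrite in_itv/= andbT lerN2.
have [|lA] := leP (2^-1 * (2 * b) ^+ d)%:E (lebesgue_rV d ([set y | u y <= m]%R `&` cube z b)).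
  by left.
right; rewrite leNgt; apply/negP => lB.
have : (lebesgue_rV d (cube z b) < ((2 * b) ^+ d)%:E)%E.
  apply: (@le_lt_trans _ _ (lebesgue_rV d ([set y | u y <= m]%R `&` cube z b) +
     lebesgue_rV d ([set y | - u y <= - m]%R `&` cube z b))%E).
    apply: (@le_trans _ _ (lebesgue_rV d (([set y | u y <= m] `&` cube z b) `|`
        ([set y | - u y <= - m] `&` cube z b)))); last exact: measureU2.
    apply: le_measure; rewrite ?inE; [exact: measurable_cube|exact: measurableU|].
    move=> y yc; have [uy|uy] := leP (u y) m; [left|right] => //; split => //=.
    by rewrite lerN2 ltW.
  apply: (lt_le_trans (lteD lA lB)); rewrite -EFinD lee_fin; lra.
by rewrite lebesgue_cube// ltxx.
Qed.

(** Lowering the ceiling from c to m increases the excess only outside the smaller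
ball, by at most 2 (1 - q) h. The old excess is halved relative to f at
the new scale, and the new mass is small because q is close to 1. *)
Lemma excess_step f x k u z (rho c h m : R) :
  good f x k -> measurable_fun setT u -> 0 < rho -> rho <= r0 -> 0 < h ->
  eball z (rho / theta / 2) x ->
  int_le k (fun y => Num.max (u y - c) 0) (eps * h * f rho^-1) ->
  c - 2 * (1 - q) * h <= m ->
  (forall y, eball z (rho / theta) y -> u y <= m) ->
  int_le k (fun y => Num.max (u y - m) 0) (eps * (q * h) * f (rho / theta)^-1).
Proof.
move=> [[fP ff0] kP _ kT _] mu rho0 rhor h0 xz ic cm um; have [mk k0 _ _] := kP.
move: (theta_ge4) (q_le1) (q_ge) (r0_gt0) => th4 ql1 qge3 r0p.
have theta0 : 0 < theta by lra.
pose s := rho / theta / 2.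
have rt0 : 0 < rho / theta by rewrite divr_gt0.
have rtr : rho / theta <= r0.
  by rewrite (le_trans _ rhor)// ler_pdivrMr// ler_peMr ?(ltW rho0)//; lra.
have s0 : 0 < s by rewrite divr_gt0.
have sr : s <= r0 by rewrite /s; lra.
have dq0 : 0 <= 2 * (1 - q) * h by rewrite !mulr_ge0 ?(ltW h0)// subr_ge0.
have f_pos := profileV_gt0 r0_gt0 a1_gt0 fP rt0 rtr.
apply: (int_le_mono _ mk k0 _ (int_le_weaken _ (int_leD ic (int_leZ dq0 (kT s s0 sr))))).
- apply: measurable_maxr; last exact: measurable_cst.
  by apply: measurable_funB; [exact: mu|exact: measurable_cst].
- move=> y; rewrite le_max lexx orbT/= indicE.
  have c0 : 0 <= Num.max (u y - c) 0 by rewrite le_max lexx orbT.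
  have c1 : u y - c <= Num.max (u y - c) 0 by rewrite le_max lexx.
  have [yz|yz] := ltP (enorm (y - z)) (rho / theta).
    rewrite [Num.max (u y - m) 0]max_r ?subr_le0 ?um//.
    by rewrite addr_ge0// mulr_ge0.
  rewrite (_ : y \in far x s)%R; last first.
    rewrite inE /far/=; have := enormB y x z; move: xz; rewrite /eball/= /s.
    lra.
  rewrite mulr1 ge_max; apply/andP; split; lra.
- have h1 : 2 * f rho^-1 <= f (rho / theta)^-1.
    apply: le_trans (profileV_ge r0_gt0 a1_gt0 fP _ rho0 rhor); last by lra.
    by rewrite ler_pM2r// (profileV_gt0 r0_gt0 a1_gt0 fP).
  have h2 : f s^-1 <= B * f (rho / theta)^-1.
    by rewrite (profileV_le r0_gt0 a1_gt0 fP)//; lra.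
  have e0 : 0 < eps by rewrite /excess_tolerance divr_gt0// kappa_gt0.
  set X := f (rho / theta)^-1 in f_pos h1 h2 *.
  have hX : 0 < h * X by rewrite mulr_gt0.
  have g1 : eps * h * (2 * f rho^-1) <= eps * h * X by rewrite ler_pM2l// mulr_gt0.
  have g2 : 2 * (1 - q) * h * (T * f s^-1) <= 2 * (1 - q) * h * (T * (B * X)).
    by rewrite ler_wpM2l// ler_pM2l.
  have g3 : 2 * (1 - q) * h * (T * (B * X)) <= eps / 4 * (h * X).
    rewrite (_ : 2 * (1 - q) * h * (T * (B * X)) = 2 * (1 - q) * T * B * (h * X)); last by ring.
    by rewrite ler_pM2r.
  have g4 : 3 / 4 * (eps * (h * X)) <= q * (eps * (h * X)).
    by rewrite ler_pM2r// mulr_gt0.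
  rewrite (_ : eps * (q * h) * X = q * (eps * (h * X))); last by ring.
  rewrite (_ : eps * h * X = eps * (h * X)) in g1; last by ring.
  rewrite (_ : eps * h * (2 * f rho^-1) = 2 * (eps * h * f rho^-1)) in g1; last by ring.
  lra.
Qed.

(** The invariant of the iteration: on the ball u is within h of a midpoint m, and far away
its excess over m + h and below m - h is negligible at scale rho. *)
Definition trapped (F : 'rV[R]_d -> set ('rV[R]_d -> R)) (f : R -> R) u z (rho h : R) :=
  exists m : R,
  [/\ forall y, eball z rho y -> m - h <= u y <= m + h,
      forall x k, eball z (rho / 2) x -> F x k ->
        int_le k (fun y => Num.max (u y - (m + h)) 0) (eps * h * f rho^-1) &
      forall x k, eball z (rho / 2) x -> F x k ->
        int_le k (fun y => Num.max (- u y - (- m + h)) 0) (eps * h * f rho^-1)].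

(** If u is below its midpoint on half of the cube, the ceiling comes down by
2 (1 - q) h, otherwise the floor goes up by as much. *)
Lemma trapped_step F f D u z (rho h : R) :
  (forall x k, F x k -> good f x k) ->
  tested r0 delta2 F D u -> tested r0 delta2 F D (fun y => - u y) ->
  usc_within D u -> usc_within D (fun y => - u y) -> measurable_fun setT u ->
  0 < rho -> 2 * rho <= r0 -> eball z rho `<=` D -> 0 < h ->
  trapped F f u z rho h -> trapped F f u z (rho / theta) (q * h).
Proof.
move=> Fgood tu tNu uu uNu mu rho0 rhor zD h0 [m [mP eP eN]].
move: (theta_ge4) (q_le1) (q_ge) (r0_gt0) => th4 ql1 qge3 r0p.
have theta0 : 0 < theta by lra.
have dR0 : 0 < d%:R :> R by rewrite ltr0n.
have rt : rho / theta <= rho / 4 by rewrite ler_pM2l// lef_pV2 ?posrE.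
have mNu : measurable_fun setT (fun y => - u y) by exact: measurable_funN.
have b0 : 0 < rho / (4 * d%:R) by rewrite divr_gt0// mulr_gt0.
have q0 : 0 < q by lra.
have qh : q * h <= h by rewrite ler_piMl// ltW.
have qgam : 2 * (1 - q) * h <= gam / 8 * h by rewrite ler_pM2r.
have sub x : eball z (rho / theta / 2) x -> eball z (rho / 2) x by rewrite /eball/=; lra.
have sub4 x : eball z (rho / theta) x -> eball z (rho / 4) x by rewrite /eball/=; lra.
have sub1 x : eball z (rho / theta) x -> eball z rho x by rewrite /eball/=; lra.
have conclude m' : m + h - 2 * (1 - q) * h <= m' + q * h ->
    - m + h - 2 * (1 - q) * h <= - m' + q * h ->
    (forall y, eball z (rho / theta) y -> m' - q * h <= u y <= m' + q * h) ->
    trapped F f u z (rho / theta) (q * h).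
  move=> mm1 mm2 m'P; exists m'; split => // x k xz Fk.
  - apply: (excess_step (Fgood _ _ Fk) mu rho0 _ h0 xz (eP x k (sub _ xz) Fk) mm1); first lra.
    by move=> y /m'P /andP[].
  - apply: (excess_step (Fgood _ _ Fk) mNu rho0 _ h0 xz (eN x k (sub _ xz) Fk) mm2); first lra.
    by move=> y /m'P /andP[+ _]; lra.
have [half|half] := cube_halves z m mu b0.
- apply: (conclude (m - (1 - q) * h)); [lra|lra|] => y yz.
  have up : forall y, eball z rho y -> u y <= m + h by move=> t /mP /andP[].
  have := diminish_above d_gt0 r0_gt0 lam_gt0 a1_gt0 a2_gt0 T_gt0 C2_gt0 C3_gt0
     Fgood tu uu mu rho0 rhor zD h0 up eP.
  rewrite addrK => /(_ half y (sub4 _ yz)).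
  by have := mP y (sub1 _ yz); lra.
- apply: (conclude (m + (1 - q) * h)); [lra|lra|] => y yz.
  have up : forall y, eball z rho y -> - u y <= - m + h.
    by move=> t /mP /andP[+ _]; lra.
  have := diminish_above d_gt0 r0_gt0 lam_gt0 a1_gt0 a2_gt0 T_gt0 C2_gt0 C3_gt0
     Fgood tNu uNu mNu rho0 rhor zD h0 up eN.
  rewrite addrK => /(_ half y (sub4 _ yz)).
  by have := mP y (sub1 _ yz); lra.
Qed.

Lemma oscillation_decay F f D u z (rho H : R) :
  (forall x k, F x k -> good f x k) ->
  tested r0 delta2 F D u -> tested r0 delta2 F D (fun y => - u y) ->
  usc_within D u -> usc_within D (fun y => - u y) -> measurable_fun setT u ->
  0 < rho -> 2 * rho <= r0 -> eball z rho `<=` D -> 0 < H ->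
  (forall y, `|u y| <= H) ->
  forall n y, eball z (rho / theta ^+ n) y -> `|u z - u y| <= 2 * (q ^+ n * H).
Proof.
move=> Fgood tu tNu uu uNu mu rho0 rhor zD H0 uH n.
move: (theta_ge4) (q_le1) (q_ge) (r0_gt0) => th4 ql1 qge3 r0p.
have theta0 : 0 < theta by lra.
have q0 : 0 < q by lra.
have thetan0 j : 0 < theta ^+ j by rewrite exprn_gt0.
have rn0 j : 0 < rho / theta ^+ j by rewrite divr_gt0.
have rnr j : rho / theta ^+ j <= rho.
  by rewrite ler_pdivrMr// ler_peMr ?(ltW rho0)// exprn_ege1//; lra.
have trap : trapped F f u z (rho / theta ^+ n) (q ^+ n * H).
  elim: n => [|n IH].
    have base (v : 'rV[R]_d -> R) x (k : 'rV[R]_d -> R) :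
        measurable_fun setT v -> (forall y, v y <= H) -> F x k ->
        int_le k (fun y => Num.max (v y - H) 0) (eps * H * f rho^-1).
      move=> mv vH /Fgood [[fP _] [mk k0 _ _] _ _ _].
      have -> : (fun y => Num.max (v y - H) 0) = cst 0.
        by apply/funext => y; rewrite max_r// subr_le0.
      have e0 : 0 < eps by rewrite divr_gt0// kappa_gt0.
      have f_pos : 0 < f rho^-1 by apply: (profileV_gt0 r0_gt0 a1_gt0 fP) => //; lra.
      apply: int_le_of_ge0 => //; first by move=> y; rewrite mul0r.
      under eq_integral do rewrite mul0r.
      by rewrite integral0 lee_fin ltW// mulr_gt0// mulr_gt0.
    rewrite !expr0 divr1 mul1r; exists 0; rewrite sub0r oppr0 add0r; split.
    - by move=> y _; rewrite -ler_norml.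
    - move=> x k _ Fk; apply: (base u x) => // y.
      exact: le_trans (ler_norm _) (uH y).
    - move=> x k _ Fk; apply: base Fk; first exact: measurable_funN.
      by move=> y; rewrite (le_trans (ler_norm _))// normrN.
  rewrite (exprSr theta) invfM mulrA (exprS q) -(mulrA q).
  apply: (trapped_step Fgood tu tNu uu uNu mu (rn0 n) _ _ _ IH).
  - by have := rnr n; lra.
  - by move=> y yz; apply: zD; move: yz (rnr n); rewrite /eball/=; lra.
  - by rewrite mulr_gt0// exprn_gt0.
move=> y yz; have [m [mP _ _]] := trap.
have := mP y yz; have := mP z; rewrite {1}/eball/= enormxx => /(_ (rn0 n)).
by rewrite ler_norml; lra.
Qed.

End oscillation.

(** * The Hoelder estimate *)

Section holder.
Context {R : realType} {d : nat}.
Implicit Types (x y z : 'rV[R]_d) (u : 'rV[R]_d -> R).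

Lemma geometric_scale (theta rho s : R) : 4 <= theta -> 0 < s -> s < rho ->
  exists n, rho / theta ^+ n.+1 <= s < rho / theta ^+ n.
Proof.
move=> t4 s0 srho; have t0 : 0 < theta by lra.
have ex : exists n, rho / theta ^+ n <= s.
  have [|n ns] := expr_unbounded (rho / s) (t := theta); first by lra.
  exists n; rewrite ler_pdivrMr ?exprn_gt0// mulrC -ler_pdivrMr//; exact: ltW.
case: (ex_minnP ex) => -[|n]; first by rewrite expr0 divr1 leNgt srho.
move=> ns nmin; exists n; rewrite ns/= ltNge; apply/negP => /nmin.
by rewrite ltnn.
Qed.

(** With theta^(-alpha) = q, the bound q^n at distance theta^(-n) rho is the power alpha
of the distance; the factor 1 / q accounts for the distances in between. *)
Lemma decay_holder u z (theta q rho H alpha : R) : 4 <= theta -> 0 < q ->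
  0 < alpha -> theta `^ (- alpha) = q -> 0 < rho -> 0 < H -> q <= 1 ->
  (forall y, `|u y| <= H) ->
  (forall n y, eball z (rho / theta ^+ n) y -> `|u z - u y| <= 2 * (q ^+ n * H)) ->
  forall y, z != y -> `|u z - u y| <= 2 / q * H * (enorm (z - y) / rho) `^ alpha.
Proof.
move=> t4 q0 alpha0 qE rho0 H0 q1 uH decay y zy.
have t0 : 0 < theta by lra.
have s0 : 0 < enorm (z - y) by rewrite enorm_gt0.
have [srho|rhos] := ltP (enorm (z - y)) rho; last first.
  apply: (@le_trans _ _ (2 * H)).
    by have := ler_normB (u z) (u y); have := uH z; have := uH y; lra.
  have X1 : 1 <= (enorm (z - y) / rho) `^ alpha.
    have -> : 1 = 1 `^ alpha by rewrite powR1.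
    apply: ge0_ler_powR; rewrite ?nnegrE ?(ltW alpha0)//.
      by rewrite divr_ge0// ltW.
    by rewrite ler_pdivlMr// mul1r.
  have qV : 1 <= q^-1 by rewrite invf_ge1.
  rewrite (_ : 2 / q * H * _ = 2 * H * (q^-1 * (enorm (z - y) / rho) `^ alpha)); last by ring.
  by rewrite ler_peMr ?mulr_ge0 ?(ltW H0)// mulr_ege1.
have [n /andP[ns sn]] := geometric_scale t4 s0 srho.
have := decay n y; rewrite /eball/= (enormC y) => /(_ sn) /le_trans; apply.
have h1 : q ^+ n.+1 <= (enorm (z - y) / rho) `^ alpha.
  rewrite -qE -powR_mulrn ?powR_ge0// -powRrM mulrC mulrN -mulNr powRrM.
  apply: ge0_ler_powR; rewrite ?nnegrE ?powR_ge0 ?divr_ge0 ?(ltW alpha0) ?(ltW s0) ?(ltW rho0)//.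
  rewrite powRN powR_mulrn ?(ltW t0)//.
  by rewrite ler_pdivlMr// mulrC.
rewrite (_ : 2 * (q ^+ n * H) = 2 / q * H * q ^+ n.+1).
  by rewrite ler_pM2l// mulr_gt0// divr_gt0.
by rewrite exprS; field; rewrite gt_eqF.
Qed.

Context (r0 M0 lam Lam a1 a2 delta1 delta2 f0 : R).
Context (d_gt0 : (0 < d)%N) (r0_gt0 : 0 < r0) (lam_gt0 : 0 < lam) (Lam_gt0 : 0 < Lam)
  (a1_gt0 : 0 < a1) (a2_gt0 : 0 < a2) (delta1_gt0 : 0 < delta1) (delta2_lt2 : delta2 < 2).

(** The three cases of the theorem enter only through the drift. All constants are
chosen before f, J and u: first theta, then the tolerance on 1 - q, and alpha is read
off from theta^(-alpha) = q. *)
Lemma holder_of_drift_bounded C3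
    (A : ('rV[R]_d -> 'rV[R]_d -> R) -> set ('rV[R]_d -> 'rV[R]_d -> R)) :
  0 < C3 ->
  (forall f J K x, admissible_profile r0 a1 a2 delta1 delta2 f -> f r0^-1 = f0 ->
     admissible_kernel r0 M0 f J -> A J K ->
     [/\ measurable_offdiag K,
         forall x y, x != y -> lam * J x y <= K x y <= Lam * J x y &
         drift_bounded r0 delta2 C3 f x (off_diagonal K x)]) ->
  exists alpha C : R, [/\ 0 < alpha, 0 < C &
    @holder_estimate R d r0 M0 a1 a2 delta1 delta2 f0
      (fun J => [set LK r0 delta2 K | K in A J]) alpha C].
Proof.
move=> C30 AP.
have [T T0 TP] := @far_mass R d r0 lam Lam (Lam * M0) a1 a2 delta1 delta2 f0
  r0_gt0 Lam_gt0 a1_gt0 delta1_gt0.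
have [C2 C20 C2P] := @near_moment R d r0 lam Lam (Lam * M0) a1 a2 delta1 delta2 f0
  r0_gt0 Lam_gt0 a1_gt0 2 isT delta2_lt2.
have [theta t4] := @exists_expanding_scale R (2 / a1) delta1 0 delta1_gt0.
rewrite expr0 mulr1 ler_pdivrMr// mulrC => tf.
pose gam := @bump_size R d lam a2 delta2 T C2 C3.
pose eps := @excess_tolerance R d lam.
pose B := @growth R a2 delta2.
have gam0 : 0 < gam by exact: bump_size_gt0.
have eps0 : 0 < eps by rewrite divr_gt0// kappa_gt0.
have B0 : 0 < B by exact: growth_gt0.
have TB0 : 0 < T * B by rewrite mulr_gt0.
(* The three bounds are those required of 1 - q by the iteration: q >= 3 / 4, the
   gain of one step, and the tolerance on the new excess. *)
pose del := Num.min 4^-1 (Num.min (gam / 16) (eps / 8 / (T * B))).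
have del0 : 0 < del.
  have g1 : 0 < gam / 16 by rewrite divr_gt0.
  have g2 : 0 < eps / 8 / (T * B) by rewrite divr_gt0// divr_gt0.
  by rewrite !lt_min g1 g2 invr_gt0 ltr0n.
have del1 : del <= 4^-1 by rewrite ge_min lexx.
have del2 : del <= gam / 16 by rewrite /del !ge_min lexx orbT.
have del3 : del * (T * B) <= eps / 8.
  by rewrite -ler_pdivlMr// /del !ge_min lexx !orbT.
pose q := 1 - del.
have q1 : q < 1 by rewrite /q; lra.
have q0 : 0 < q by rewrite /q; lra.
have t0 : 0 < theta by lra.
have lt0 : 0 < ln theta by rewrite ln_gt0//; lra.
pose alpha := - ln q / ln theta.
have alpha0 : 0 < alpha by rewrite divr_gt0// oppr_gt0 ln_lt0// q0.
have qE : theta `^ (- alpha) = q.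
  rewrite /powR gt_eqF// (_ : - alpha * ln theta = ln q); last first.
    by rewrite /alpha; field; rewrite gt_eqF.
  by rewrite lnK// posrE.
exists alpha, (2 / q * 2 `^ alpha); split => //.
  by rewrite mulr_gt0 ?powR_gt0// divr_gt0.
move=> f J fP ff0 JP z0 r u r0' bu mu vu1 vu2.
have A0 K : A J K -> forall x y, x != y -> 0 <= K x y.
  move=> AK x y xy; have [_ + _] := AP f J K 0 fP ff0 JP AK.
  move=> /(_ x y xy) /andP[+ _]; apply: le_trans.
  by case: JP => J0 _ _ _; rewrite mulr_ge0 ?(ltW lam_gt0)// J0.
have tu := visc_ge0_tested A0 vu1; have tNu := visc_le0_tested A0 vu2.
pose D := eball z0 r.
have uu : usc_within D u.
  by apply: usc_within_sub (usc_on_within vu1.1); exact: subset_closure.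
have uNu : usc_within D (fun y => - u y).
  apply: (@usc_within_sub _ _ _ (closure D)); first exact: subset_closure.
  apply: usc_on_within; rewrite /usc_on.
  rewrite (_ : (fun y => - - u y) = u); first exact: vu2.1.
  by apply/funext => y; rewrite opprK.
have Fgood x k : kernels_at (A J) x k ->
    good_kernel r0 lam Lam (Lam * M0) a1 a2 delta1 delta2 f0 T C2 C3 f x k.
  move=> [K AK <-]; have [mK KJ dK] := AP f J K x fP ff0 JP AK.
  have kP := kernel_at_of_bounds x r0_gt0 lam_gt0 Lam_gt0 JP mK KJ.
  by split => //; [exact: TP|exact: C2P].
pose rm := Num.min r r0; have rm0 : 0 < rm by rewrite lt_min r0' r0_gt0.
have rmr : rm <= r by rewrite ge_min lexx.
have rmr0 : rm <= r0 by rewrite ge_min lexx orbT.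
have ubu : has_ubound [set `|u x| | x in [set: 'rV[R]_d]].
  case: bu => N [_ Nu]; exists (N + 1) => _ [y _ <-].
  by apply: Nu => //; rewrite ltrDl.
pose H := sup_norm u.
have uH y : `|u y| <= H by apply: ub_le_sup => //; exists y.
apply: ge_ereal_sup => _ [[x y] /= [xD yD xy] <-]; rewrite lee_fin.
have s0 : 0 < enorm (x - y) by rewrite enorm_gt0.
rewrite ler_pdivrMr ?powR_gt0//.
have [H0|H0] := ltP 0 H; last first.
  have u0 t : u t = 0.
    by apply/eqP; rewrite -normr_eq0 eq_le normr_ge0 (le_trans (uH t)).
  rewrite !u0 subrr normr0 -/H (_ : H = 0) ?mulr0 ?mul0r//.
  by apply/eqP; rewrite eq_le H0/= (le_trans _ (uH x)).
(* Half of min (r, r0): the ball stays in the domain and 2 rho <= r0. *)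
pose rho := rm / 2; have rho0 : 0 < rho by rewrite divr_gt0.
have zD : eball x rho `<=` D.
  move=> t xt; have := enormB t x z0; move: xt xD; rewrite /D /eball/= /rho; lra.
have decay : forall n t, eball x (rho / theta ^+ n) t -> `|u x - u t| <= 2 * (q ^+ n * H).
  apply: (oscillation_decay d_gt0 r0_gt0 lam_gt0 a1_gt0 a2_gt0 T0 C20 C30 t4 tf
    _ _ _ _ Fgood tu tNu uu uNu mu rho0 _ zD H0 uH).
  - exact: ltW.
  - by rewrite /q; lra.
  - by rewrite -/gam /q; lra.
  - by rewrite -/B -/eps /q -mulrA; lra.
  - by rewrite /rho; lra.
apply: (le_trans (decay_holder t4 q0 alpha0 qE rho0 H0 (ltW q1) uH decay xy)).
rewrite le_eqVlt; apply/orP; left; apply/eqP.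
rewrite /rho (_ : enorm (x - y) / (rm / 2) = 2 * (1 / rm) * enorm (x - y)); last first.
  by field; rewrite gt_eqF.
have rmV : 0 <= rm^-1 by rewrite invr_ge0 ltW.
have rmV1 : 0 <= 1 / rm by rewrite div1r.
rewrite powRM ?enorm_ge0 ?mulr_ge0//.
rewrite powRM// -/rm -/H; set X := (1 / rm) `^ _.
ring.
Qed.

End holder.

Theorem theorem1p1 (R : realType) (d : nat)
    (r0 M0 lam Lam a1 a2 delta1 delta2 f0 : R)
    (d_ge1 : (1 <= d)%N) (r0_gt0 : 0 < r0) (lam_gt0 : 0 < lam)
    (lam_le_Lam : lam <= Lam) (a1_gt0 : 0 < a1) (a2_gt0 : 0 < a2)
    (delta1_02 : 0 < delta1 < 2) (delta2_02 : 0 < delta2 < 2) :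
  (1 < delta1 < 2 \/ 0 < delta2 < 1 ->
   exists alpha C : R, [/\ 0 < alpha, 0 < C &
     @holder_estimate R d r0 M0 a1 a2 delta1 delta2 f0
       (Lclass r0 lam Lam delta2) alpha C])
  /\
  (delta1 <= 1 <= delta2 ->
   exists alpha C : R, [/\ 0 < alpha, 0 < C &
     @holder_estimate R d r0 M0 a1 a2 delta1 delta2 f0
       (Lsym r0 lam Lam delta2) alpha C]).
Proof.
have Lam_gt0 : 0 < Lam by exact: lt_le_trans lam_le_Lam.
have [/andP[d1 _] /andP[_ d2]] := (delta1_02, delta2_02).
split => [d12|/andP[_ d2ge]].
- have [C3 C30 C3P] : exists2 C, 0 < C & forall f x k,
      admissible_profile r0 a1 a2 delta1 delta2 f /\ f r0^-1 = f0 ->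
      kernel_at r0 lam Lam (Lam * M0) f x k -> @drift_bounded R d r0 delta2 C f x k.
    have [d2lt|d2ge] := ltP delta2 1.
      exact: (drift_bounded_low_order _ _ _ _ _ _).
    case: d12 => [/andP[d1gt _]|/andP[_]]; last by rewrite ltNge d2ge.
    exact: drift_bounded_high_order.
  apply: (holder_of_drift_bounded d_ge1 r0_gt0 lam_gt0 Lam_gt0 a1_gt0 a2_gt0 d1 d2 C30)
    => f J K x fP ff0 JP [mK KJ].
  split => //; apply: C3P => //.
  exact: kernel_at_of_bounds JP mK KJ.
- apply: (holder_of_drift_bounded d_ge1 r0_gt0 lam_gt0 Lam_gt0 a1_gt0 a2_gt0 d1 d2 ltr01)
    => f J K x fP ff0 JP [mK KJ Ksym].
  split => //.
  have kP := kernel_at_of_bounds x r0_gt0 lam_gt0 Lam_gt0 JP mK KJ.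
  have := drift_bounded_symmetric r0_gt0 Lam_gt0 a1_gt0 d2ge (conj fP ff0) kP.
  apply.
  move=> z z0; rewrite /off_diagonal.
  have -> : (x + z == x) = false.
    by apply/negbTE; rewrite -subr_eq0 addrAC subrr add0r.
  have -> : (x - z == x) = false.
    by apply/negbTE; rewrite -subr_eq0 addrAC subrr add0r oppr_eq0.
  exact: Ksym.
Qed.
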